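(* Let $\mathfrak{B}$ be a unital $C^*$-algebra with unit $I_{\mathfrak{B}}$, and let $A\in\mathfrak{B}$ be self-adjoint with $A^2-A\ge 0$. Let $\mathfrak{A}=M_2(\mathfrak{B})$, regarded as a Hilbert module over itself, let $\ell(A)=(A^2-A)^{1/2}\in\mathfrak{B}$, and let $P,Q\in\mathfrak{A}$ be defined by $$P=\begin{pmatrix} I_{\mathfrak{B}} & 0\\ 0 & 0\end{pmatrix},\quad Q=\begin{pmatrix} A & -\ell(A)\\ \ell(A) & I_{\mathfrak{B}}-A\end{pmatrix}.$$ Then $(P,Q)$ is semi-harmonious if and only if $$I_{\mathfrak{B}}\in\overline{\mathcal{R}(A-I_{\mathfrak{B}})}+\mathcal{N}(A-I_{\mathfrak{B}}),$$ where $\mathcal{R}(A-I_{\mathfrak{B}})=\{(A-I_{\mathfrak{B}})x:x\in\mathfrak{B}\}$ and $\mathcal{N}(A-I_{\mathfrak{B}})=\{x\in\mathfrak{B}:(A-I_{\mathfrak{B}})x=0\}$.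
   Context: For a unital $C^*$-algebra $\mathfrak{C}$, $\mathfrak{C}$ is a right Hilbert $\mathfrak{C}$-module with inner product $\langle x,y\rangle=x^*y$, and $\mathfrak{C}$ is identified with the algebra $\mathcal{L}(\mathfrak{C})$ of adjointable operators on it via $b\mapsto L_b$, $L_b(x)=bx$. This is applied to $\mathfrak{C}=\mathfrak{A}=M_2(\mathfrak{B})$ (the $2\times2$ matrices over $\mathfrak{B}$), so $P,Q\in\mathfrak{A}$ are viewed as operators on the Hilbert $\mathfrak{A}$-module $\mathscr{H}=\mathfrak{A}$, with identity operator $I$. The bar denotes norm closure; for an operator $T$, $\mathcal{R}(T)$ denotes its range and $|T|=(T^*T)^{1/2}$. For a Hilbert $C^*$-module $\mathscr{H}$, a closed submodule $\mathscr{M}$ is orthogonally complemented in $\mathscr{H}$ if $\mathscr{H}=\mathscr{M}+\mathscr{M}^\perp$; then $P_{\mathscr{M}}$ is the projection onto $\mathscr{M}$. $T\in\mathcal{L}(\mathscr{H})$ has the polar decomposition if there is a partial isometry $U\in\mathcal{L}(\mathscr{H})$ with $T=U|T|$ and $U^*U=P_{\overline{\mathcal{R}(T^* )}}$ (in particular $\overline{\mathcal{R}(T^* )}$ is orthogonally complemented). A quasi-projection pair $(P,Q)$ on $\mathscr{H}$ consists of a projection $P$ (self-adjoint idempotent) and an idempotent $Q$ in $\mathcal{L}(\mathscr{H})$ such that $PQ^*P=PQP$, $PQ^*(I-P)=-PQ(I-P)$ and $(I-P)Q^*(I-P)=(I-P)Q(I-P)$; equivalently, $Q^*=(2P-I)Q(2P-I)$.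 A quasi-projection pair $(P,Q)$ is semi-harmonious if both $P(I-Q)$ and $(I-P)Q$ have the polar decomposition. The pair $(P,Q)$ in the claim is a quasi-projection pair on $\mathfrak{A}$. *)

(* Defs.v *)
From HB Require Import structures.
From mathcomp Require Import all_boot all_order all_algebra.
From mathcomp Require Import complex.
From mathcomp Require Import all_classical all_reals all_analysis.

Set Implicit Arguments.
Unset Strict Implicit.
Unset Printing Implicit Defensive.

Import Order.TTheory GRing.Theory Num.Theory.
Import numFieldNormedType.Exports.

Local Open Scope classical_set_scope.
Local Open Scope ring_scope.
Local Open Scope complex_scope.

HB.mixin Record Algebra_isStarAlgebra (C : numClosedFieldType) A
    of GRing.Algebra C A := {
  star : A -> A;
  starK : forall x : A, star (star x) = x;
  starD : forall x y : A, star (x + y) = star x + star y;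
  starM : forall x y : A, star (x * y) = star y * star x;
  starZ : forall (a : C) (x : A), star (a *: x) = Num.conj a *: star x
}.

#[short(type="starAlgType")]
HB.structure Definition StarAlgebra (C : numClosedFieldType) :=
  {A of GRing.Algebra C A & Algebra_isStarAlgebra C A}.

(* The norm is a field of the structure, and not a [completeNormedModType]
   structure, because Hierarchy-Builder cannot join the latter with [algType]. *)
HB.mixin Record StarAlgebra_isCStarAlgebra (R : realType) A
    of StarAlgebra R[i] A := {
  cnorm : A -> R;
  cnorm_eq0 : forall x : A, cnorm x = 0 -> x = 0;
  ler_cnormD : forall x y : A, cnorm (x + y) <= cnorm x + cnorm y;
  cnormZ : forall (a : R[i]) (x : A),
    cnorm (a *: x) = complex.Re `|a| * cnorm x;
  ler_cnormM : forall x y : A, cnorm (x * y) <= cnorm x * cnorm y;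
  cnorm_starM : forall x : A, cnorm (star x * x) = cnorm x ^+ 2;
  cnorm_complete : forall u : nat -> A,
    (forall e : R, 0 < e -> exists N, forall m n,
      (N <= m)%N -> (N <= n)%N -> cnorm (u m - u n) < e) ->
    exists l : A, (fun n => cnorm (u n - l)) @ \oo --> (0 : R)
}.

#[short(type="cstarAlgType")]
HB.structure Definition CStarAlgebra (R : realType) :=
  {A of StarAlgebra R[i] A & StarAlgebra_isCStarAlgebra R A}.

Section StarAlgebraTheory.
Variables (C : numClosedFieldType) (A : starAlgType C).
Implicit Types (a b p q t u s x y : A) (M : set A).

Definition selfadjoint a := star a = a.

Definition projection p := selfadjoint p /\ p * p = p.

Definition idempotent_elt q := q * q = q.

Definition partial_isometry u := u * star u * u = u.

Definition invertible a := exists b, a * b = 1 /\ b * a = 1.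

Definition spectrum a : set C := [set l | ~ invertible (l *: 1 - a)].

(* [0 <= l] in a [numClosedFieldType] entails that [l] is real. *)
Definition positive_elt a := selfadjoint a /\ spectrum a `<=` [set l | 0 <= l].

Definition sqrt_spec a s := positive_elt s /\ s * s = a.

(* Intended for positive [a], which in a C*-algebra have exactly one positive
   square root. *)
Definition sqrt_elt a : A := xget 0 [set s | sqrt_spec a s].

Definition abs_elt t : A := sqrt_elt (star t * t).

(* A as a right Hilbert module over itself; [b : A] stands for the adjointable
   operator [x |-> b * x]. *)
Definition inner x y : A := star x * y.

Definition op_range t : set A := range (fun x => t * x).

Definition op_kernel t : set A := [set x | t * x = 0].

Definition orthogonal M : set A := [set y | forall x, M x -> inner x y = 0].

Definition set_sum M N : set A := [set x + y | x in M & y in N].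

Definition orth_complemented M := set_sum M (orthogonal M) = setT.

Definition projection_onto M p := projection p /\ op_range p = M.

Definition quasi_projection_pair p q :=
  [/\ projection p,
      idempotent_elt q,
      p * star q * p = p * q * p,
      p * star q * (1 - p) = - (p * q * (1 - p)) &
      (1 - p) * star q * (1 - p) = (1 - p) * q * (1 - p)].

(* [nrm] is the norm of the Hilbert module A. *)
Variables (R : realType) (nrm : A -> R).

Definition norm_closure M : set A :=
  [set x | forall e : R, 0 < e -> exists2 y, M y & nrm (x - y) < e].

Definition has_polar_decomposition t :=
  let M := norm_closure (op_range (star t)) in
  orth_complemented M /\
  exists u, [/\ partial_isometry u, t = u * abs_elt t &
                projection_onto M (star u * u)].

Definition semi_harmonious p q :=
  [/\ quasi_projection_pair p q,
      has_polar_decomposition (p * (1 - q)) &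
      has_polar_decomposition ((1 - p) * q)].

End StarAlgebraTheory.

(* M_2(B) as a complex *-algebra; the alias is needed because the library
   makes ['M[B]_2] a module over B rather than over the scalars of B. *)
Definition mxalg2 (C : numClosedFieldType) (B : starAlgType C) := 'M[B]_2.

Section MatrixAlgebra.
Variables (C : numClosedFieldType) (B : starAlgType C).

HB.instance Definition _ := GRing.NzRing.copy (mxalg2 B) 'M[B]_2.

Definition mx_cscale (a : C) (T : mxalg2 B) : mxalg2 B :=
  map_mx (fun x => a *: x) T.

Definition mx_star (T : mxalg2 B) : mxalg2 B :=
  (map_mx (@star C B) T)^T.

Lemma mx_cscaleA a b T : mx_cscale a (mx_cscale b T) = mx_cscale (a * b) T.
Proof. by apply/matrixP => i j; rewrite !mxE scalerA. Qed.

Lemma mx_cscale1 : left_id 1 mx_cscale.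
Proof. by move=> T; apply/matrixP => i j; rewrite !mxE scale1r. Qed.

Lemma mx_cscaleDr : right_distributive mx_cscale +%R.
Proof. by move=> a S T; apply/matrixP => i j; rewrite !mxE scalerDr. Qed.

Lemma mx_cscaleDl T : {morph mx_cscale^~ T : a b / a + b}.
Proof. by move=> a b; apply/matrixP => i j; rewrite !mxE scalerDl. Qed.

HB.instance Definition _ := GRing.Zmodule_isLmodule.Build C (mxalg2 B)
  mx_cscaleA mx_cscale1 mx_cscaleDr mx_cscaleDl.

Lemma mx_cscalerAl (a : C) (S T : mxalg2 B) : a *: (S * T) = (a *: S) * T.
Proof.
apply/matrixP => i j; rewrite !mxE scaler_sumr; apply: eq_bigr => k _.
by rewrite !mxE scalerAl.
Qed.

Lemma mx_cscalerAr (a : C) (S T : mxalg2 B) : a *: (S * T) = S * (a *: T).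
Proof.
apply/matrixP => i j; rewrite !mxE scaler_sumr; apply: eq_bigr => k _.
by rewrite !mxE scalerAr.
Qed.

Lemma mx_starK (T : mxalg2 B) : mx_star (mx_star T) = T.
Proof. by apply/matrixP => i j; rewrite !mxE starK. Qed.

Lemma mx_starD (S T : mxalg2 B) : mx_star (S + T) = mx_star S + mx_star T.
Proof. by apply/matrixP => i j; rewrite !mxE starD. Qed.

Lemma mx_starM (S T : mxalg2 B) : mx_star (S * T) = mx_star T * mx_star S.
Proof.
apply/matrixP => i j; rewrite !mxE.
have star0 : star (0 : B) = 0.
  by apply: (addrI (star (0 : B))); rewrite -starD !addr0.
rewrite (big_morph _ (@starD C B) star0); apply: eq_bigr => k _.
by rewrite !mxE starM.
Qed.

Lemma mx_starZ (a : C) (T : mxalg2 B) :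
  mx_star (a *: T) = Num.conj a *: mx_star T.
Proof. by apply/matrixP => i j; rewrite !mxE starZ. Qed.

HB.instance Definition _ := GRing.Lmodule_isLalgebra.Build C (mxalg2 B)
  mx_cscalerAl.

HB.instance Definition _ := GRing.Lalgebra_isAlgebra.Build C (mxalg2 B)
  mx_cscalerAr.

HB.instance Definition _ := Algebra_isStarAlgebra.Build C (mxalg2 B)
  mx_starK mx_starD mx_starM mx_starZ.

End MatrixAlgebra.

Section MatrixNorm.
Variables (R : realType) (B : cstarAlgType R).

(* The norm of the Hilbert B-module B^2 of columns. *)
Definition column_norm (x : 'cV[B]_2) : R :=
  Num.sqrt (cnorm (\sum_i star (x i ord0) * x i ord0)).

(* The C*-norm of M_2(B): the operator norm of its action on B^2. *)
Definition mx_opnorm (T : mxalg2 B) : R :=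
  sup [set column_norm (T *m x) | x in [set x | column_norm x <= 1]].

End MatrixNorm.

Definition mx22 (C : numClosedFieldType) (B : starAlgType C) (a b c d : B) :
    mxalg2 B :=
  \matrix_(i < 2, j < 2)
    if i == ord0 then (if j == ord0 then a else b)
    else (if j == ord0 then c else d).

(* Main.v *)
Require Import Defs.
From HB Require Import structures.
From mathcomp Require Import all_boot all_order all_algebra.
From mathcomp Require Import complex.
From mathcomp Require Import all_classical all_reals all_analysis.
From mathcomp Require Import ring lra.
Import Order.TTheory GRing.Theory Num.Theory.
Import numFieldNormedType.Exports.
Local Open Scope classical_set_scope.
Local Open Scope ring_scope.
Set Implicit Arguments.
Unset Strict Implicit.
Unset Printing Implicit Defensive.

(** Everything rests on a fact about a single element [t] of a unital
    C*-algebra: [t] has a polar decomposition if and only if the closed range of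
    [t] is the range of a projection [q], which then lies in this closed range
    and satisfies [q t = t] ([polarP]). If [t = u |t|], then [q = u u^*] works,
    because [u t^* = t u^*]. Conversely, if [e] is such a projection for [t^*],
    then [e] is a limit of elements [|t| x_n]; since [|t x| = ||t| x|] in norm,
    [t x_n] converges, and its limit is the partial isometry. The two directions
    together pass from [t] to [t^*], so the projection for [t] suffices.

    Moreover [t] and [t t^*] have the same closed range
    ([closure_range_mul_star]). For [P (1 - Q)] and [(1 - P) Q] the product
    [t t^*] is a matrix whose only nonzero entry, on the diagonal, is
    [(1 - A)^2 + ell^2 = (A - 1) (2 A - 1)]. Here [2 A - 1] is invertible, its
    square being [1 + 4 (A^2 - A)], so both operators have a polar decomposition
    if and only if the closed range of [A - 1] in [B] is the range of a
    projection ([semi_harmoniousP]). As [A - 1] is self-adjoint, its kernel is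
    orthogonal to its range, and such a projection exists exactly when [1] is the
    sum of an element of the closed range and one of the kernel
    ([range_kernel_decompositionP]).

    The argument uses that [t^* t] has a positive square root, both in [B] and in
    [M_2(B)], and that positive elements are ordered compatibly with the norm.
    These facts are derived from the C*-identity without the spectral radius
    formula. The norm of a self-adjoint [a], up to sign, is in the spectrum of
    [a], by an estimate on the partial sums of a geometric series
    ([not_invertible_1B_sqr]). Hence a self-adjoint [a] is positive if and only
    if [|t - a| <= t] for some real [t] ([positive_near], [near_positive]), from
    which sums, square roots and the positivity of [x^* x] follow. The
    Cauchy-Schwarz inequality in [B^2] then makes [M_2(B)] a C*-algebra for its
    operator norm. *)

(** * Arithmetic of the involution and of the norm *)

Section StarArith.
Variables (C : numClosedFieldType) (A : starAlgType C).
Implicit Types x y : A.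

Lemma star0 : star (0 : A) = 0.
Proof. by apply: (addrI (star (0 : A))); rewrite -starD !addr0. Qed.

Lemma starN x : star (- x) = - star x.
Proof. by apply: (addrI (star x)); rewrite -starD !subrr star0. Qed.

Lemma starB x y : star (x - y) = star x - star y.
Proof. by rewrite starD starN. Qed.

Lemma star1 : star (1 : A) = 1.
Proof. by rewrite -[LHS]mulr1 -{2}(starK (1 : A)) -starM mulr1 starK. Qed.

Lemma invertibleM x y : invertible x -> invertible y -> invertible (x * y).
Proof.
move=> [x' [xx' x'x]] [y' [yy' y'y]]; exists (y' * x'); split.
  by rewrite mulrA -(mulrA x) yy' mulr1.
by rewrite mulrA -(mulrA y') x'x mulr1.
Qed.

Lemma invertibleN x : invertible x -> invertible (- x).
Proof. by move=> [y [xy yx]]; exists (- y); rewrite !mulrNN. Qed.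

Lemma invertibleZ (a : C) x : a != 0 -> invertible x -> invertible (a *: x).
Proof.
move=> a0 [y [xy yx]]; exists (a^-1 *: y).
by rewrite -!scalerAl -!scalerAr !scalerA mulfV ?mulVf // !scale1r.
Qed.

Lemma invertible_sqr x : invertible (x * x) -> invertible x.
Proof.
move=> [y [xy yx]]; exists (x * y); split; first by rewrite mulrA.
have -> : x * y = y * x; last by rewrite -mulrA.
by rewrite -[x * y]mul1r -yx -!mulrA (mulrA x x y) xy mulr1.
Qed.

(** The inverse of [r + y x] is [(1 - y (r + x y)^-1 x) / r], as the geometric
    series suggests: [x y] and [y x] have the same nonzero spectrum. *)
Lemma invertible_swap (r : C) x y :
  r != 0 -> invertible (r *: 1 + x * y) -> invertible (r *: 1 + y * x).
Proof.
move=> r0 [z [xz zx]]; exists (r^-1 *: (1 - y * z * x)).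
have e1 : x * y * z = 1 - r *: z.
  by apply/eqP; rewrite eq_sym subr_eq -xz mulrDl -scalerAl mul1r addrC.
have e2 : z * (x * y) = 1 - r *: z.
  by apply/eqP; rewrite eq_sym subr_eq -zx mulrDr -scalerAr mulr1 addrC.
split.
  rewrite -scalerAr mulrDl -scalerAl mul1r mulrBr mulr1.
  have -> : y * x * (y * z * x) = y * (x * y * z) * x by rewrite !mulrA.
  rewrite e1 mulrBr mulr1 mulrBl -scalerAr -scalerAl subKr.
  by rewrite scalerBr addrNK scalerA mulVf // scale1r.
rewrite -scalerAl mulrDr -scalerAr mulr1 mulrBl mul1r.
have -> : y * z * x * (y * x) = y * (z * (x * y)) * x by rewrite !mulrA.
rewrite e2 mulrBr mulr1 mulrBl -scalerAr -scalerAl subKr.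
by rewrite scalerBr addrNK scalerA mulVf // scale1r.
Qed.

End StarArith.

Section CNorm.
Local Open Scope complex_scope.
Variables (R : realType) (A : cstarAlgType R).
Implicit Types (x y a b h l k : A) (r t e : R) (u : nat -> A).

Lemma star_realZ r x : star (r%:C *: x) = r%:C *: star x.
Proof.
by rewrite starZ; congr (_ *: _); apply/CrealP; rewrite complex_real.
Qed.

Lemma cnormZr r x : cnorm (r%:C *: x) = `|r| * cnorm x.
Proof. by rewrite cnormZ normc_def /= expr0n addr0 sqrtr_sqr. Qed.

Lemma cnorm0 : cnorm (0 : A) = 0.
Proof. by rewrite -(scale0r (0 : A)) (cnormZr 0) normr0 mul0r. Qed.

Lemma cnormN x : cnorm (- x) = cnorm x.
Proof.
have -> : - x = (-1)%:C *: x by rewrite rmorphN1 scaleN1r.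
by rewrite cnormZr normrN1 mul1r.
Qed.

Lemma cnorm_ge0 x : 0 <= cnorm x.
Proof.
have := ler_cnormD x (- x); rewrite subrr cnorm0 cnormN; lra.
Qed.

Lemma cnormB x y : cnorm (x - y) = cnorm (y - x).
Proof. by rewrite -cnormN opprB. Qed.

Lemma ler_cnormB x y : cnorm (x - y) <= cnorm x + cnorm y.
Proof. by rewrite -(cnormN y) ler_cnormD. Qed.

Lemma cnorm_le_star x : cnorm x <= cnorm (star x).
Proof.
have [->|x0] := eqVneq (cnorm x) 0; first exact: cnorm_ge0.
have xp : 0 < cnorm x by rewrite lt_neqAle eq_sym x0 cnorm_ge0.
by rewrite -(ler_pM2r xp) -expr2 -cnorm_starM ler_cnormM.
Qed.

Lemma cnorm_star x : cnorm (star x) = cnorm x.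
Proof.
by apply/eqP; rewrite eq_le cnorm_le_star -{2}(starK x) cnorm_le_star.
Qed.

Lemma cnorm_sqr h : selfadjoint h -> cnorm (h * h) = cnorm h ^+ 2.
Proof. by move=> hh; rewrite -cnorm_starM hh. Qed.

Lemma star_mul_eq0 x : star x * x = 0 -> x = 0.
Proof.
move=> x0; apply: cnorm_eq0; apply/eqP.
by rewrite -sqrf_eq0 -cnorm_starM x0 cnorm0.
Qed.

Lemma cnorm1 : cnorm (1 : A) = 1.
Proof.
have n0 : cnorm (1 : A) != 0.
  by apply/eqP => /cnorm_eq0/eqP; apply/negP; rewrite oner_eq0.
by apply: (mulfI n0); rewrite -expr2 -cnorm_starM star1 !mulr1.
Qed.

Lemma cnorm_real r : cnorm (r%:C *: (1 : A)) = `|r|.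
Proof. by rewrite cnormZr cnorm1 mulr1. Qed.

(** * Sequences converging in norm *)

Definition tendsto (u : nat -> A) (l : A) :=
  (fun n => cnorm (u n - l)) @ \oo --> (0 : R).

Lemma tendsto_le (v : nat -> R) u l :
  (forall n, cnorm (u n - l) <= v n) -> v @ \oo --> (0 : R) -> tendsto u l.
Proof.
move=> uv v0; refine (squeeze_cvgr _ (cvg_cst (0 : R)) v0).
by near=> n; rewrite cnorm_ge0 uv.
Unshelve. all: by end_near. Qed.

Lemma tendsto_near u l e : tendsto u l -> 0 < e ->
  exists N, forall n, (N <= n)%N -> cnorm (u n - l) < e.
Proof.
move=> ul e0; have [N _ HN] : \forall n \near \oo, cnorm (u n - l) < e.
  exact: (cvgr_lt _ ul).
by exists N => n Nn; apply: HN.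
Qed.

Lemma tendsto_cst l : tendsto (fun=> l) l.
Proof. by rewrite /tendsto subrr cnorm0; apply: cvg_cst. Qed.

Lemma tendsto_shift u l : tendsto u l -> tendsto (fun n => u n.+1) l.
Proof. by move=> ul; rewrite /tendsto (cvg_shiftS (fun n => cnorm (u n - l))). Qed.

Lemma tendstoD u v l k : tendsto u l -> tendsto v k ->
  tendsto (fun n => u n + v n) (l + k).
Proof.
move=> ul vk; refine (@tendsto_le (fun n => cnorm (u n - l) + cnorm (v n - k)) _ _ _ _).
  by move=> n; rewrite opprD addrACA ler_cnormD.
by rewrite -(addr0 0); apply: cvgD.
Qed.

Lemma tendstoM u v l k : tendsto u l -> tendsto v k ->
  tendsto (fun n => u n * v n) (l * k).
Proof.
move=> ul vk; refine (@tendsto_le (fun n => cnorm (u n - l) * (cnorm (v n - k) + cnorm k) +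
  cnorm l * cnorm (v n - k)) _ _ _ _).
  move=> n; have -> : u n * v n - l * k = (u n - l) * v n + l * (v n - k).
    by rewrite mulrBl mulrBr addrA subrK.
  apply: le_trans (ler_cnormD _ _) _; apply: lerD; last exact: ler_cnormM.
  apply: le_trans (ler_cnormM _ _) _; apply: ler_wpM2l; first exact: cnorm_ge0.
  by rewrite -{1}(subrK k (v n)) ler_cnormD.
have -> : (0 : R) = 0 * (0 + cnorm k) + cnorm l * 0 by rewrite mul0r mulr0 addr0.
apply: cvgD; apply: cvgM => //; last exact: cvg_cst.
by apply: cvgD => //; apply: cvg_cst.
Qed.

Lemma tendstoZ c u l : tendsto u l -> tendsto (fun n => c *: u n) (c *: l).
Proof.
move=> ul; have := tendstoM (tendsto_cst (c *: 1)) ul.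
by under eq_fun do rewrite -scalerAl mul1r; rewrite -scalerAl mul1r.
Qed.

Lemma tendsto_star u l : tendsto u l -> tendsto (fun n => star (u n)) (star l).
Proof.
rewrite /tendsto => ul.
by under eq_fun do rewrite -starB cnorm_star.
Qed.

Lemma tendsto_norm_le u l r :
  tendsto u l -> (forall n, cnorm (u n) <= r) -> cnorm l <= r.
Proof.
move=> ul ur; rewrite leNgt; apply/negP => rl.
have [|N /(_ N (leqnn N))] := tendsto_near ul (e := cnorm l - r).
  by rewrite subr_gt0.
rewrite ltrBrDr cnormB => lt1; have := ler_cnormD (l - u N) (u N).
by rewrite subrK leNgt (le_lt_trans _ lt1) // lerD2l ur.
Qed.

Lemma tendsto_unique u l k : tendsto u l -> tendsto u k -> l = k.
Proof.
move=> ul uk; apply/eqP; rewrite -subr_eq0; apply/eqP/cnorm_eq0/eqP.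
rewrite eq_le cnorm_ge0 andbT.
have vk := tendstoD ul (tendstoZ (-1) uk).
rewrite scaleN1r in vk; apply: (tendsto_norm_le vk) => n.
by rewrite scaleN1r subrr cnorm0.
Qed.

Lemma tendsto_comm u l c : tendsto u l -> (forall n, c * u n = u n * c) ->
  c * l = l * c.
Proof.
move=> ul uc; apply: (tendsto_unique (tendstoM (tendsto_cst c) ul)).
under eq_fun do rewrite uc.
exact: tendstoM ul (tendsto_cst c).
Qed.

Lemma tendsto_selfadjoint u l :
  tendsto u l -> (forall n, selfadjoint (u n)) -> selfadjoint l.
Proof.
move=> ul us; apply: (tendsto_unique (tendsto_star ul)).
by under eq_fun do rewrite us.
Qed.

Lemma cauchy_tendsto u :
  (forall e : R, 0 < e -> exists N, forall m n,
     (N <= m)%N -> (N <= n)%N -> cnorm (u m - u n) < e) -> exists l, tendsto u l.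
Proof. exact: cnorm_complete. Qed.

(** The increments of [u] are dominated by those of an increasing bounded real
    sequence, so [u] is a Cauchy sequence. *)
Lemma dominated_tendsto (u : nat -> A) (t : nat -> R) (M : R) :
  (forall n, cnorm (u n.+1 - u n) <= t n.+1 - t n) -> (forall n, t n <= M) ->
  exists l, tendsto u l.
Proof.
move=> ut tM.
have t_incr n : t n <= t n.+1.
  by rewrite -subr_ge0; apply: le_trans (ut n); exact: cnorm_ge0.
have nd : nondecreasing_seq t by apply/nondecreasing_seqP.
have utn n j : cnorm (u (n + j)%N - u n) <= t (n + j)%N - t n.
  elim: j => [|j IH]; first by rewrite addn0 !subrr cnorm0.
  rewrite addnS -(subrKA (u (n + j)%N)) -(subrKA (t (n + j)%N)).
  by apply: le_trans (ler_cnormD _ _) _; apply: lerD.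
have tc : cvgn t.
  apply: nondecreasing_is_cvgn => //; exists M => _ [n _ <-]; exact: tM.
set T := lim (t @ \oo) in tc *.
have tT n : t n <= T by apply: nondecreasing_cvgn_le.
apply: cauchy_tendsto => e e0.
have [N _ HN] : \forall n \near \oo, T - e / 2 < t n.
  by apply: (cvgr_gt _ tc); rewrite ltrBlDr ltrDl divr_gt0.
have main m : (N <= m)%N -> cnorm (u m - u N) < e / 2.
  move=> Nm; rewrite -(subnKC Nm); apply: le_lt_trans (utn _ _) _.
  have := HN N (leqnn N); have := tT (N + (m - N))%N; rewrite /=; lra.
exists N => m n Nm Nn; rewrite -(subrKA (u N)).
apply: le_lt_trans (ler_cnormD _ _) _.
rewrite [e]splitr ltrD ?main // cnormB main //.
Qed.

Lemma norm_closureP (M : set A) x :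
  norm_closure (@cnorm R A) M x <->
  exists u, (forall n, M (u n)) /\ tendsto u x.
Proof.
split=> [Mx|[u [uM ux]] e e0]; last first.
  have [N HN] := tendsto_near ux e0.
  by exists (u N) => //; rewrite cnormB; apply: HN.
have Mn n : exists y, M y /\ cnorm (x - y) < n.+1%:R^-1.
  by have [|y My xy] := Mx (n.+1%:R^-1); [rewrite invr_gt0|exists y].
have [u Hu] := choice Mn; exists u; split=> [n|]; first by have [] := Hu n.
refine (@tendsto_le harmonic _ _ _ _); last exact: cvg_harmonic.
by move=> n; rewrite cnormB ltW //; have [] := Hu n.
Qed.

End CNorm.

(** * The spectrum of a self-adjoint element *)

Section Spectrum.
Local Open Scope complex_scope.
Variables (R : realType) (A : cstarAlgType R).
Implicit Types (x y a b h w v : A) (r t : R).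

Lemma selfadjointD x y : selfadjoint x -> selfadjoint y -> selfadjoint (x + y).
Proof. by rewrite /selfadjoint starD => -> ->. Qed.

Lemma selfadjointN x : selfadjoint x -> selfadjoint (- x).
Proof. by rewrite /selfadjoint starN => ->. Qed.

Lemma selfadjointB x y : selfadjoint x -> selfadjoint y -> selfadjoint (x - y).
Proof. by move=> sx sy; apply/selfadjointD/selfadjointN. Qed.

Lemma selfadjointZ r x : selfadjoint x -> selfadjoint (r%:C *: x).
Proof. by rewrite /selfadjoint star_realZ => ->. Qed.

Lemma selfadjoint1 : selfadjoint (1 : A).
Proof. exact: star1. Qed.

Lemma selfadjoint_real r : selfadjoint (r%:C *: (1 : A)).
Proof. exact/selfadjointZ/selfadjoint1. Qed.

Lemma selfadjointM x y :
  selfadjoint x -> selfadjoint y -> GRing.comm x y -> selfadjoint (x * y).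
Proof. by rewrite /selfadjoint starM => -> -> ->. Qed.

Lemma selfadjoint_sqr x : selfadjoint x -> selfadjoint (x * x).
Proof. by move=> sx; apply: selfadjointM. Qed.

Lemma selfadjointX x n : selfadjoint x -> selfadjoint (x ^+ n).
Proof.
move=> sx; elim: n => [|n IH]; first exact: selfadjoint1.
by rewrite exprS; apply: selfadjointM => //; apply: commrX.
Qed.

Lemma selfadjoint_star_mul x : selfadjoint (star x * x).
Proof. by rewrite /selfadjoint starM starK. Qed.

Lemma cnormX_le x n : cnorm (x ^+ n) <= cnorm x ^+ n.
Proof.
elim: n => [|n IH]; first by rewrite !expr0 cnorm1.
rewrite !exprS; apply: le_trans (ler_cnormM _ _) _.
by apply: ler_wpM2l => //; exact: cnorm_ge0.
Qed.

(** The inverse is the sum of the Neumann series. *)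
Lemma invertible_1B x : cnorm x < 1 -> invertible (1 - x).
Proof.
move=> x1; set q := cnorm x in x1; have q0 : 0 <= q by exact: cnorm_ge0.
pose u n := \sum_(0 <= k < n) x ^+ k.
have uS n : u n.+1 = u n + x ^+ n by rewrite /u big_nat_recr.
have uxl n : u n.+1 = 1 + x * u n.
  rewrite /u big_nat_recl // expr0 mulr_sumr; congr (_ + _).
  by apply: eq_bigr => i _; rewrite exprS.
have uxr n : u n.+1 = 1 + u n * x.
  rewrite /u big_nat_recl // expr0 mulr_suml; congr (_ + _).
  by apply: eq_bigr => i _; rewrite exprSr.
have d0 : 1 - q != 0 by rewrite subr_eq0 eq_sym lt_eqF.
have [|n|l ul] := @dominated_tendsto _ _ u (fun n => (1 - q ^+ n) / (1 - q)) (1 - q)^-1.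
- move=> n; rewrite uS addrAC subrr add0r.
  have -> : (1 - q ^+ n.+1) / (1 - q) - (1 - q ^+ n) / (1 - q) = q ^+ n.
    by rewrite exprS; field.
  exact: cnormX_le.
- rewrite ler_pdivrMr ?subr_gt0 // mulVf // lerBlDr lerDl; exact: exprn_ge0.
have c1 := tendsto_cst (1 : A); have cx := tendsto_cst x.
have lE1 : l = 1 + x * l.
  apply: (tendsto_unique (tendsto_shift ul)); under eq_fun do rewrite uxl.
  exact: tendstoD c1 (tendstoM cx ul).
have lE2 : l = 1 + l * x.
  apply: (tendsto_unique (tendsto_shift ul)); under eq_fun do rewrite uxr.
  exact: tendstoD c1 (tendstoM ul cx).
exists l; rewrite mulrBl mulrBr mul1r mulr1 {1}lE1 {3}lE2.
by rewrite !addrK.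
Qed.

Lemma invertible_scalarB (c : R[i]) x :
  cnorm x < complex.Re `|c| -> invertible (c *: 1 - x).
Proof.
move=> xc; have c0 : c != 0.
  apply: contraTneq xc => ->; rewrite normr0 /= -leNgt; exact: cnorm_ge0.
have -> : c *: 1 - x = c *: (1 - c^-1 *: x).
  by rewrite scalerBr scalerA mulfV // scale1r.
apply: invertibleZ => //; apply: invertible_1B.
have cp : 0 < complex.Re `|c| by apply: le_lt_trans xc; exact: cnorm_ge0.
rewrite cnormZ -(ltr_pM2r cp) mul1r mulrAC.
have -> : complex.Re `|c^-1| * complex.Re `|c| = 1.
  have := cnormZ c^-1 (c *: (1 : A)).
  by rewrite scalerA mulVf // scale1r cnormZ cnorm1 mulr1.
by rewrite mul1r.
Qed.

Lemma invertible_realB r x : cnorm x < r -> invertible (r%:C *: 1 - x).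
Proof.
move=> xr; apply: invertible_scalarB; rewrite normc_def /= expr0n addr0 sqrtr_sqr.
by rewrite ger0_norm // ltW // (le_lt_trans _ xr) // cnorm_ge0.
Qed.

Lemma star_imZ r x : star ((0 +i* r) *: x) = - ((0 +i* r) *: star x).
Proof.
rewrite starZ -scaleNr; congr (_ *: _).
by apply/eqP; rewrite eq_complex /= oppr0 !eqxx.
Qed.

(** For real [l], [|h + i l|^2 = |h^2 + l^2| <= |h|^2 + l^2], which is smaller
    than [(1 + l)^2] once [l] is large, for instance [l = |h|^2]; hence
    [i (1 + l)] is not in the spectrum of [h + i l]. *)
Lemma invertible_iB h : selfadjoint h -> invertible ((0 +i* 1) *: 1 - h).
Proof.
move=> sh; set l := cnorm h ^+ 2; have l0 : 0 <= l by exact: sqr_ge0.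
have -> : (0 +i* 1) *: 1 - h = (0 +i* (1 + l)) *: 1 - (h + (0 +i* l) *: 1).
  rewrite opprD addrCA addrC -scalerBl; congr (_ *: _ - _).
  by apply/eqP; rewrite eq_complex /= subrr addrK !eqxx.
apply: invertible_scalarB; rewrite normc_def /= expr0n add0r sqrtr_sqr.
rewrite ger0_norm ?addr_ge0 // -(ltr_pXn2r (n := 2)) ?nnegrE ?addr_ge0 ?cnorm_ge0 //.
rewrite -cnorm_starM starD star_imZ star1 sh mulrDl !mulrDr !mulNr.
have -> : (0 +i* l) *: 1 * ((0 +i* l) *: (1 : A)) = - ((l ^+ 2)%:C *: 1).
  rewrite -scalerAl mul1r scalerA -scaleNr; congr (_ *: _).
  apply/eqP; rewrite eq_complex /=; apply/andP; split; apply/eqP; ring.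
rewrite opprK -scalerAr mulr1 -scalerAl mul1r addrA addrK.
apply: le_lt_trans (ler_cnormD _ _) _.
rewrite cnorm_sqr // cnorm_real ger0_norm ?sqr_ge0 // -/l; nra.
Qed.

Lemma invertible_nonreal (c : R[i]) h :
  selfadjoint h -> complex.Im c != 0 -> invertible (c *: 1 - h).
Proof.
case: c => p q /= sh q0.
have -> : (p +i* q) *: 1 - h =
    q%:C *: ((0 +i* 1) *: 1 - q^-1%:C *: (h - p%:C *: 1)).
  rewrite scalerBr !scalerA -rmorphM mulfV // scale1r opprB addrA -scalerDl.
  congr (_ *: _ - _); apply/eqP; rewrite eq_complex /=.
  by apply/andP; split; apply/eqP; ring.
apply: invertibleZ; first by rewrite eq_complex /= (negbTE q0).
apply: invertible_iB; apply/selfadjointZ/selfadjointB => //.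
exact: selfadjoint_real.
Qed.

Lemma invertible_1D_sqr h : selfadjoint h -> invertible (1 + h * h).
Proof.
move=> sh; have -> : 1 + h * h =
    - (((0 +i* 1) *: 1 - h) * ((0 +i* 1) *: 1 - (- h))).
  rewrite opprK mulrDr !mulrBl -!scalerAl -!scalerAr !mul1r mulr1 scalerA.
  have -> : (0 +i* 1) * (0 +i* 1) = - 1 :> R[i].
    apply/eqP; rewrite eq_complex /=; apply/andP; split; apply/eqP; ring.
  by rewrite scaleN1r subrKA opprB opprK addrC.
by apply/invertibleN/invertibleM; apply: invertible_iB => //; apply: selfadjointN.
Qed.

Lemma invertible_realD_sqr r h :
  0 < r -> selfadjoint h -> invertible (r%:C *: 1 + h * h).
Proof.
move=> r0 sh; set s := Num.sqrt r.
have ss : s * s = r by rewrite -expr2 sqr_sqrtr // ltW.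
have s0 : s != 0 by rewrite gt_eqF // sqrtr_gt0.
have -> : r%:C *: 1 + h * h = r%:C *: (1 + s^-1%:C *: h * (s^-1%:C *: h)).
  rewrite -scalerAl -scalerAr !scalerA scalerDr scalerA -!rmorphM -ss.
  have -> : s * s * (s^-1 * s^-1) = 1 by field.
  by rewrite scale1r.
apply: invertibleZ; first by rewrite eq_complex /= gt_eqF.
by apply: invertible_1D_sqr; apply: selfadjointZ.
Qed.

(** With [z = x + i y], [x^2 + y^2 = z^* z] has norm [|z|^2], and [x], the real
    part of [z], has norm at most [|z|]. *)
Lemma cnorm_sqr_leD x y : selfadjoint x -> selfadjoint y -> GRing.comm x y ->
  cnorm x ^+ 2 <= cnorm (x * x + y * y).
Proof.
move=> sx sy xy; set z := x + (0 +i* 1) *: y.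
have sz : star z = x - (0 +i* 1) *: y by rewrite starD star_imZ sx sy.
have -> : x * x + y * y = star z * z.
  rewrite sz mulrBl !mulrDr -!scalerAl -!scalerAr scalerA xy opprD addrA addrK.
  congr (_ + _); rewrite -scaleNr.
  have -> : - ((0 +i* 1) * (0 +i* 1)) = 1 :> R[i].
    apply/eqP; rewrite eq_complex /=; apply/andP; split; apply/eqP; ring.
  by rewrite scale1r.
rewrite cnorm_starM; apply: lerXn2r; rewrite ?nnegrE ?cnorm_ge0 //.
have := ler_cnormD z (star z).
have -> : z + star z = 2%:C *: x.
  by rewrite sz addrACA subrr addr0 -[in LHS](scale1r x) -scalerDl -rmorphD.
by rewrite cnormZr cnorm_star (ger0_norm (ler0n _ 2)); lra.
Qed.

(** [(1 + a^2) (1 + a^4) ... (1 + a^(2^k))]: the partial sum of the geometric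
    series of [a^2], in a form to which [(1 + d)^2 = 4 d + (1 - d)^2] applies
    factor by factor. *)
Fixpoint geomprod (k : nat) a : A :=
  if k is j.+1 then geomprod j (a * a) * (1 + a * a) else 1.

Lemma geomprodE k a : geomprod k a * (1 - a * a) = 1 - a ^+ (2 ^ k.+1).
Proof.
elim: k a => [|k IH] a /=; first by rewrite mul1r expn1 expr2.
have -> : a ^+ (2 ^ k.+2) = (a * a) ^+ (2 ^ k.+1).
  by rewrite expnS exprM expr2.
rewrite -IH -mulrA; congr (_ * _).
by rewrite mulrDl mul1r mulrBr mulr1 addrA subrK.
Qed.

Lemma comm_1D_sqr a v : GRing.comm a v -> GRing.comm (1 + a * a) v.
Proof.
move=> av; apply/commr_sym/commrD; first exact: commr1.
by apply: commrM; apply: commr_sym.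
Qed.

Lemma cnorm_1D_sqr_mul a v : selfadjoint a -> selfadjoint v -> GRing.comm a v ->
  4 * cnorm (a * v) ^+ 2 <= cnorm ((1 + a * a) * v) ^+ 2.
Proof.
move=> sa sv av.
have sq x y : GRing.comm x y -> (x * y) * (x * y) = x * x * (y * y).
  by move=> xy; rewrite -!mulrA; congr (_ * _); rewrite !mulrA xy.
have saa := selfadjoint_sqr sa.
have cv := comm_1D_sqr av.
have cm : GRing.comm (1 - a * a) v.
  apply/commr_sym/commrB; first exact: commr1.
  by apply: commrM; apply: commr_sym.
have c2 : GRing.comm (2%:C *: a) v.
  by rewrite /GRing.comm -scalerAl -scalerAr av.
have s2 : selfadjoint (2%:C *: a) by apply: selfadjointZ.
have sm : selfadjoint (1 - a * a) by apply: selfadjointB => //; exact: selfadjoint1.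
rewrite -[leRHS]cnorm_sqr; last first.
  by apply: selfadjointM => //; apply: selfadjointD => //; exact: selfadjoint1.
rewrite (sq _ _ cv).
have -> : (1 + a * a) * (1 + a * a) * (v * v) =
    (2%:C *: a * v) * (2%:C *: a * v) + ((1 - a * a) * v) * ((1 - a * a) * v).
  rewrite (sq _ _ c2) (sq _ _ cm) -mulrDl; congr (_ * _).
  rewrite -scalerAl -scalerAr scalerA -rmorphM -(opprB _ 1) mulrNN -!expr2.
  rewrite addrC sqrrD1 sqrrB1; set d := a ^+ 2.
  have -> : (2 * 2)%:C *: d = d *+ 2 + d *+ 2.
    by rewrite -mulrnDr -[RHS]scaler_nat; congr (_ *: _); rewrite -natrM rmorph_nat.
  by rewrite -!addrA !(addrCA d (d ^+ 2)) (addrA d d (d *- 2 + 1)) -mulr2n addNKr.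
have -> : 4 * cnorm (a * v) ^+ 2 = cnorm (2%:C *: a * v) ^+ 2.
  rewrite -scalerAl cnormZr (ger0_norm (ler0n _ 2)) exprMn.
  by congr (_ * _); ring.
apply: cnorm_sqr_leD; try exact: selfadjointM.
have ca x : GRing.comm (1 - a * a) x -> GRing.comm v x ->
    GRing.comm x ((1 - a * a) * v) by move=> h1 h2; apply: commrM; apply: commr_sym.
apply: ca; last by apply: commrM; [exact: commr_sym|exact: commr_refl].
apply: commrM => //; rewrite /GRing.comm -scalerAl -scalerAr; congr (_ *: _).
by rewrite mulrBl mulrBr mul1r mulr1 mulrA.
Qed.

(** The factor [w] absorbs, at each step of the induction, the factors of the
    product that have not been estimated yet. *)
Lemma cnorm_geomprod k a w :
  selfadjoint a -> selfadjoint w -> GRing.comm a w ->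
  4 ^+ k * cnorm (a ^+ (2 ^ k).-1 * w) ^+ 2 <= cnorm (geomprod k a * w) ^+ 2.
Proof.
elim: k a w => [|k IH] a w sa sw aw; first by rewrite expr0 !mul1r.
have saa := selfadjoint_sqr sa.
have aaw : GRing.comm (a * a) w by apply/commr_sym/commrM; apply: commr_sym.
have c1 := comm_1D_sqr aw.
rewrite /= -mulrA; apply: le_trans (IH _ _ saa _ _); last 2 first.
- by apply: selfadjointM => //; apply: selfadjointD => //; exact: selfadjoint1.
- apply: commrM => //; apply: commrD; first exact: commr1.
  exact: commr_refl.
rewrite exprSr -mulrA ler_pM2l ?exprn_gt0 //.
have cp : GRing.comm (1 + a * a) ((a * a) ^+ (2 ^ k).-1).
  apply: comm_1D_sqr; apply: commrX; apply: commrM; exact: commr_refl.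
rewrite (mulrA _ _ w) -cp -(mulrA _ _ w).
have -> : a ^+ (2 ^ k.+1).-1 * w = a * ((a * a) ^+ (2 ^ k).-1 * w).
  rewrite mulrA -expr2 -exprM -exprS; congr (_ ^+ _ * _).
  have : (0 < 2 ^ k)%N by rewrite expn_gt0.
  by rewrite expnS; case: (2 ^ k)%N => [|n] // _; rewrite mulnS.
apply: cnorm_1D_sqr_mul => //.
  apply: selfadjointM; [exact: selfadjointX|by []|].
  by apply/commr_sym/commrX/commr_sym.
by apply: commrM => //; apply: commrX; apply: commrM; exact: commr_refl.
Qed.

(** If [1 - a^2] had a right inverse [b], the partial sums of the geometric
    series of [a^2] would be bounded by [2 |b|]; but its first [2^k] terms add up to an
    element of norm at least [2^k]. *)
Lemma not_invertible_1B_sqr a :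
  selfadjoint a -> cnorm a = 1 -> ~ invertible (1 - a * a).
Proof.
move=> sa a1 [b [ab _]].
have pow1 k : cnorm (a ^+ (2 ^ k)) = 1.
  elim: k => [|k IH]; first by rewrite expr1.
  rewrite expnS mulnC exprM expr2 cnorm_sqr; last exact: selfadjointX.
  by rewrite IH expr1n.
have upper k : cnorm (geomprod k a) <= 2 * cnorm b.
  have -> : geomprod k a = (1 - a ^+ (2 ^ k.+1)) * b.
    by rewrite -geomprodE -mulrA ab mulr1.
  apply: le_trans (ler_cnormM _ _) _; apply: ler_wpM2r; first exact: cnorm_ge0.
  by apply: le_trans (ler_cnormB _ _) _; rewrite cnorm1 pow1.
have lower k : 2 ^+ k <= cnorm (geomprod k a).
  rewrite -(ler_pXn2r (n := 2)) ?nnegrE ?cnorm_ge0 ?exprn_ge0 //.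
  have := cnorm_geomprod k sa selfadjoint1 (commr1 a); rewrite !mulr1.
  apply: le_trans; rewrite -exprM mulnC exprM.
  have -> : 2 ^+ 2 = 4 :> R by ring.
  rewrite ler_peMr ?exprn_ge0 //; apply: exprn_ege1.
  have := ler_cnormM a (a ^+ (2 ^ k).-1).
  by rewrite -exprS prednK ?expn_gt0 // pow1 a1 mul1r.
have := archi_boundP (mulr_ge0 (ler0n R 2) (cnorm_ge0 b)).
set k := Num.bound _ => hk; have := le_trans (lower k) (upper k).
rewrite leNgt (lt_trans hk) // -natrX ltr_nat; exact: ltn_expl.
Qed.

Lemma not_invertible_norm a : selfadjoint a -> 0 < cnorm a ->
  invertible ((cnorm a)%:C *: 1 - a) -> invertible ((cnorm a)%:C *: 1 + a) ->
  False.
Proof.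
move=> sa; set r := cnorm a => r0 im ip.
have rC : r^-1%:C != 0 by rewrite eq_complex /= invr_eq0 gt_eqF.
have rr : r^-1%:C * r%:C = 1 by rewrite -rmorphM mulVf // gt_eqF.
apply: (@not_invertible_1B_sqr (r^-1%:C *: a)).
- exact: selfadjointZ.
- by rewrite cnormZr ger0_norm ?invr_ge0 ?ltW // mulVf // gt_eqF.
have -> : 1 - r^-1%:C *: a * (r^-1%:C *: a) =
    (r^-1%:C *: (r%:C *: 1 - a)) * (r^-1%:C *: (r%:C *: 1 + a)).
  rewrite scalerBr scalerDr scalerA rr scale1r mulrBl !mulrDr !mul1r !mulr1.
  by rewrite opprD addrA addrK.
by apply: invertibleM; apply: invertibleZ.
Qed.

End Spectrum.

(** * Positive elements and square roots *)

Section Positive.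
Local Open Scope complex_scope.
Variables (R : realType) (A : cstarAlgType R).
Implicit Types (x y z a b h s c : A) (r t : R).

Lemma positive_eltP a : positive_elt a <->
  selfadjoint a /\ forall r, 0 < r -> invertible (r%:C *: 1 + a).
Proof.
split=> -[sa Ha]; split=> //.
  move=> r r0; apply: contrapT => nr.
  have : spectrum a (- r)%:C.
    move=> /invertibleN; rewrite opprB -scaleNr -rmorphN opprK addrC; exact: nr.
  by move/Ha; rewrite /= lecE /= oppr_ge0 leNgt r0 andbF.
move=> c sc /=; have [ci|ci] := eqVneq (complex.Im c) 0; last first.
  by case: sc; apply: invertible_nonreal.
case: c ci sc => p q /= -> sc; rewrite lecE /= eqxx /= leNgt; apply/negP => p0.
apply: sc; have -> : (p +i* 0) *: 1 - a = - ((- p)%:C *: 1 + a).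
  by rewrite opprD -scaleNr; congr (_ *: _ - _); rewrite -rmorphN opprK.
by apply/invertibleN/Ha; rewrite oppr_gt0.
Qed.

Lemma positive_selfadjoint a : positive_elt a -> selfadjoint a.
Proof. by case. Qed.

Lemma positive_invertible a r :
  positive_elt a -> 0 < r -> invertible (r%:C *: 1 + a).
Proof. by move=> /positive_eltP[_]; apply. Qed.

(** Together with [near_positive], this trades a condition on the spectrum for
    one on the norm, to which the triangle inequality applies; that is why sums
    of positive elements are positive. *)
Lemma positive_near a t :
  selfadjoint a -> cnorm (t%:C *: 1 - a) <= t -> positive_elt a.
Proof.
move=> sa ta; apply/positive_eltP; split=> // r r0.
have -> : r%:C *: 1 + a = (r + t)%:C *: 1 - (t%:C *: 1 - a).
  by rewrite rmorphD scalerDl opprB addrA addrAC addrK.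
by apply: invertible_realB; rewrite ltr_pwDl.
Qed.

Lemma near_positive a t : positive_elt a -> cnorm a <= t ->
  cnorm (t%:C *: 1 - a) <= t.
Proof.
move=> pa at0; have sa := positive_selfadjoint pa.
set b := t%:C *: 1 - a; rewrite leNgt; apply/negP => tb.
have t0 : 0 <= t by apply: le_trans at0; exact: cnorm_ge0.
have sb : selfadjoint b by apply: selfadjointB => //; exact: selfadjoint_real.
apply: (not_invertible_norm sb); first exact: le_lt_trans tb.
  have -> : (cnorm b)%:C *: 1 - b = (cnorm b - t)%:C *: 1 + a.
    by rewrite rmorphB scalerBl opprB addrA addrAC.
  by apply: positive_invertible => //; rewrite subr_gt0.
rewrite addrA -scalerDl -rmorphD; apply: invertible_realB.
by apply: le_lt_trans at0 _; rewrite ltrDr (le_lt_trans t0 tb).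
Qed.

Lemma positiveD a b : positive_elt a -> positive_elt b -> positive_elt (a + b).
Proof.
move=> pa pb; apply: (@positive_near _ (cnorm a + cnorm b)).
  by apply: selfadjointD; apply: positive_selfadjoint.
rewrite rmorphD scalerDl opprD addrACA; apply: le_trans (ler_cnormD _ _) _.
by apply: lerD; apply: near_positive.
Qed.

Lemma positiveZ a r : 0 <= r -> positive_elt a -> positive_elt (r%:C *: a).
Proof.
move=> r0 pa; apply: (@positive_near _ (r * cnorm a)).
  exact/selfadjointZ/positive_selfadjoint.
rewrite rmorphM -scalerA -scalerBr cnormZr ger0_norm //.
by apply: ler_wpM2l => //; apply: near_positive.
Qed.

Lemma positive0 : positive_elt (0 : A).
Proof. by apply: (@positive_near _ 0); rewrite /selfadjoint ?star0 // scale0r subr0 cnorm0. Qed.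

Lemma positive_sqr h : selfadjoint h -> positive_elt (h * h).
Proof.
move=> sh; apply/positive_eltP; split; first exact: selfadjoint_sqr.
by move=> r r0; apply: invertible_realD_sqr.
Qed.

Lemma positive_normB h t :
  selfadjoint h -> cnorm h <= t -> positive_elt (t%:C *: 1 - h).
Proof.
move=> sh ht; apply: (@positive_near _ t).
  by apply: selfadjointB => //; exact: selfadjoint_real.
by rewrite subKr.
Qed.

Lemma cnorm_le_positive a t :
  0 <= t -> positive_elt a -> positive_elt (t%:C *: 1 - a) -> cnorm a <= t.
Proof.
move=> t0 pa pt; rewrite leNgt; apply/negP => ta.
have a0 := le_lt_trans t0 ta.
apply: (not_invertible_norm (positive_selfadjoint pa) a0).
  have -> : (cnorm a)%:C *: 1 - a = (cnorm a - t)%:C *: 1 + (t%:C *: 1 - a).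
    by rewrite addrA -scalerDl -rmorphD subrK.
  by apply: positive_invertible => //; rewrite subr_gt0.
exact: positive_invertible.
Qed.

Lemma cnorm_positive_mono a b :
  positive_elt a -> positive_elt (b - a) -> cnorm a <= cnorm b.
Proof.
move=> pa pb; have p : positive_elt b by rewrite -(subrK a b); apply: positiveD.
apply: cnorm_le_positive => //; first exact: cnorm_ge0.
rewrite -(subrKA b); apply: positiveD => //; apply: positive_normB => //.
exact: positive_selfadjoint.
Qed.

Lemma positive_anti a : positive_elt a -> positive_elt (- a) -> a = 0.
Proof.
move=> pa na; apply: cnorm_eq0; apply/eqP; rewrite eq_le cnorm_ge0 andbT.
by rewrite -(@cnorm0 _ A) cnorm_positive_mono // sub0r.
Qed.

(** With [z = 1 - a], the iteration [y <- (z + y^2) / 2] has the fixed point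
    [1 - sqrt a]. Because [|z| <= 1], it is dominated by the scalar iteration
    [t <- (1 + t^2) / 2] from [0], which is increasing and bounded by [1]. *)
Lemma sqrt_near1 a : selfadjoint a -> cnorm (1 - a) <= 1 ->
  exists s, [/\ positive_elt s, s * s = a &
    forall c, GRing.comm c a -> GRing.comm c s].
Proof.
move=> sa; set z := 1 - a => z1.
have sz : selfadjoint z by apply: selfadjointB => //; exact: selfadjoint1.
pose y n := iter n (fun v => 2^-1%:C *: (z + v * v)) (0 : A).
pose t n := iter n (fun v : R => 2^-1 * (1 + v * v)) 0.
have yS n : y n.+1 = 2^-1%:C *: (z + y n * y n) by [].
have tS n : t n.+1 = 2^-1 * (1 + t n * t n) by [].
have t01 n : 0 <= t n <= 1.
  elim: n => [|n IH]; first by rewrite lexx ler01.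
  by rewrite tS; nra.
have t0 n : 0 <= t n by case/andP: (t01 n).
have t1 n : t n <= 1 by case/andP: (t01 n).
have cy c : GRing.comm c a -> forall n, GRing.comm c (y n).
  move=> ca; elim=> [|n IH]; first exact: commr0.
  rewrite yS /GRing.comm -scalerAl -scalerAr; congr (_ *: _).
  apply: commrD; last exact: commrM.
  by apply: commrB => //; exact: commr1.
have yy m n : GRing.comm (y m) (y n) by apply: (cy); apply/commr_sym/cy/commr_refl.
have sy n : selfadjoint (y n).
  elim: n => [|n IH]; first exact: star0.
  by rewrite yS; apply: selfadjointZ; apply: selfadjointD => //; apply: selfadjoint_sqr.
have half : `|2^-1 : R| = 2^-1 by rewrite ger0_norm // invr_ge0.
have yt n : cnorm (y n) <= t n.
  elim: n => [|n IH]; first by rewrite cnorm0.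
  rewrite yS cnormZr half tS ler_pM2l ?invr_gt0 //.
  apply: le_trans (ler_cnormD _ _) _; apply: lerD => //.
  by rewrite cnorm_sqr // -expr2 lerXn2r ?nnegrE ?cnorm_ge0.
have dy n : cnorm (y n.+1 - y n) <= t n.+1 - t n.
  elim: n => [|n IH].
    by rewrite yS tS /= !subr0 !mulr0 !addr0 cnormZr half ler_wpM2l // invr_ge0.
  have -> : y n.+2 - y n.+1 = 2^-1%:C *: ((y n.+1 - y n) * (y n.+1 + y n)).
    rewrite (yS n.+1) {2}yS -scalerBr; congr (_ *: _).
    rewrite opprD addrACA subrr add0r mulrBl !mulrDr (yy n n.+1).
    by rewrite opprD addrA addrK.
  have -> : t n.+2 - t n.+1 = 2^-1 * ((t n.+1 - t n) * (t n.+1 + t n)).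
    by rewrite (tS n.+1); have := tS n; move: (t n.+1) (t n) => p q ->; field.
  rewrite cnormZr half ler_pM2l ?invr_gt0 //.
  apply: le_trans (ler_cnormM _ _) _; apply: ler_pM; rewrite ?cnorm_ge0 //.
  by apply: le_trans (ler_cnormD _ _) _; apply: lerD.
have [l yl] := dominated_tendsto dy t1.
have lE : l = 2^-1%:C *: (z + l * l).
  apply: (tendsto_unique (tendsto_shift yl)).
  exact: tendstoZ (tendstoD (tendsto_cst z) (tendstoM yl yl)).
have lz : l + l = z + l * l.
  rewrite -[RHS](scale1r) -(_ : 2%:C * 2^-1%:C = 1); last first.
    by rewrite -rmorphM mulfV // pnatr_eq0.
  by rewrite -scalerA -lE -[in LHS](scale1r l) -scalerDl -rmorphD.
exists (1 - l); split.
- apply: (@positive_near _ 1).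
    by apply: selfadjointB; [exact: selfadjoint1|exact: tendsto_selfadjoint yl _].
  rewrite scale1r subKr; apply: tendsto_norm_le yl _ => n.
  exact: le_trans (yt n) (t1 n).
- rewrite mulrBl mul1r mulrBr mulr1 opprB.
  have -> : l * l = l + l - z by rewrite lz addrAC subrr add0r.
  by rewrite (addrAC _ _ (- l)) addrK subrKA subKr.
move=> c ca; apply: commrB; first exact: commr1.
exact: tendsto_comm yl (cy _ ca).
Qed.

Lemma sqrt_exists a : positive_elt a ->
  exists s, [/\ positive_elt s, s * s = a &
    forall c, GRing.comm c a -> GRing.comm c s].
Proof.
move=> pa; have [a0|a0] := eqVneq (cnorm a) 0.
  move/cnorm_eq0 : a0 => ->; exists 0; rewrite mulr0; split=> [|//|c _].
    exact: positive0.
  exact: commr0.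
set t := cnorm a in a0; have tp : 0 < t by rewrite lt_neqAle eq_sym a0 cnorm_ge0.
have t0 := ltW tp.
have tC : t%:C * t^-1%:C = 1 by rewrite -rmorphM mulfV.
have [||s [ps ss cs]] := @sqrt_near1 (t^-1%:C *: a).
- exact/selfadjointZ/positive_selfadjoint.
- have -> : 1 - t^-1%:C *: a = t^-1%:C *: (t%:C *: 1 - a).
    by rewrite scalerBr scalerA mulrC tC scale1r.
  rewrite cnormZr ger0_norm ?invr_ge0 // mulrC ler_pdivrMr // mul1r.
  exact: near_positive.
exists ((Num.sqrt t)%:C *: s); split.
- by apply: positiveZ => //; exact: sqrtr_ge0.
- rewrite -scalerAl -scalerAr scalerA -rmorphM -expr2 sqr_sqrtr // ss.
  by rewrite scalerA tC scale1r.
- move=> c ca; rewrite /GRing.comm -scalerAl -scalerAr cs //.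
  by rewrite /GRing.comm -scalerAl -scalerAr ca.
Qed.

(** Unlike conjugation by an arbitrary element, this case needs only squares of
    self-adjoint elements, and it serves to prove that [x^* x] is positive. *)
Lemma positive_conj_comm h a : selfadjoint h -> positive_elt a ->
  GRing.comm h a -> positive_elt (h * a * h).
Proof.
move=> sh /sqrt_exists[s [ps ss cs]] /cs hs.
have -> : h * a * h = (h * s) * (h * s) by rewrite {2}hs -ss !mulrA.
apply: positive_sqr; apply: selfadjointM => //; exact: positive_selfadjoint.
Qed.

(** Let [r] be the square root from [sqrt_exists] and [d = s - r]. As [s] and [r]
    commute, [d (s + r) = 0], so the positive elements [d s d] and [d r d] add up
    to [0] and both vanish; their difference is [d^3]. *)
Lemma sqrt_unique a s c : positive_elt a -> positive_elt s -> s * s = a ->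
  GRing.comm c a -> GRing.comm c s.
Proof.
move=> pa ps ss ca; have [r [pr rr cr]] := sqrt_exists pa.
suff -> : s = r by exact: cr.
have sr : GRing.comm s r by apply: cr; rewrite /GRing.comm -ss mulrA.
have ss' := positive_selfadjoint ps; have sr' := positive_selfadjoint pr.
set d := s - r; have sd : selfadjoint d by apply: selfadjointB.
have cds : GRing.comm d s by apply/commr_sym/commrB => //; exact: commr_refl.
have cdr : GRing.comm d r.
  by apply/commr_sym/commrB; [exact: commr_sym|exact: commr_refl].
have d0 : d * (s + r) = 0.
  by rewrite mulrBl !mulrDr ss rr sr opprD addrA addrK subrr.
have p1 := positive_conj_comm sd ps cds; have p2 := positive_conj_comm sd pr cdr.
have e : d * s * d + d * r * d = 0 by rewrite -mulrDl -mulrDr d0 mul0r.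
have e1 : d * s * d = 0.
  by apply: positive_anti => //; rewrite -(addKr (d * s * d) (d * r * d)) e addr0 in p2.
have e2 : d * r * d = 0 by rewrite e1 add0r in e.
have d3 : d * d * d = 0 by rewrite -[RHS](subrr 0) -{1}e1 -e2 -mulrBl -mulrBr.
have d2 : d * d = 0.
  by apply: star_mul_eq0; rewrite (selfadjoint_sqr sd) mulrA d3 mul0r.
by apply/eqP; rewrite -subr_eq0; apply/eqP; apply: star_mul_eq0; rewrite sd.
Qed.

Lemma positive_swap x y :
  selfadjoint (y * x) -> positive_elt (x * y) -> positive_elt (y * x).
Proof.
move=> sa /positive_eltP[_ pxy]; apply/positive_eltP; split=> // r r0.
by apply: invertible_swap; [rewrite eq_complex /= gt_eqF|exact: pxy].
Qed.

Lemma positive_starD y : positive_elt (star y * y + y * star y).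
Proof.
set i : R[i] := 0 +i* 1; have ii : - (i * i) = 1.
  by apply/eqP; rewrite eq_complex /=; apply/andP; split; apply/eqP; ring.
have -> : star y * y + y * star y = 2^-1%:C *:
    ((y + star y) * (y + star y) + i *: (y - star y) * (i *: (y - star y))).
  rewrite -scalerAl -scalerAr scalerA -[i * i]opprK ii scaleN1r.
  rewrite mulrBl mulrDl !mulrDr !mulrN.
  set p := star y * y; set q := y * star y.
  have -> : y * y + q + (p + star y * star y) -
      (y * y - q - (p - star y * star y)) = 2%:C *: (p + q).
    rewrite rmorph_nat scaler_nat mulr2n.
    move: (y * y) (star y * star y) => f g.
    rewrite !opprD !opprK !addrA.
    by rewrite [LHS](ACl (3*2*7*6*(1*5)*(4*8)))%AC /= !subrr !addr0.
  by rewrite scalerA -rmorphM mulVf ?scale1r // pnatr_eq0.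
apply: positiveZ; first by rewrite invr_ge0.
apply: positiveD; apply: positive_sqr.
  by rewrite /selfadjoint starD starK addrC.
by rewrite /selfadjoint star_imZ starB starK -scalerN opprB.
Qed.

(** Let [a = x^* x], [b = |a|] and [y = x (b - a)]. Then [y^* y] is
    [- b (b - a)^2], which is negative, whereas [y y^*] has the same nonzero
    spectrum and [y^* y + y y^*] is a sum of squares: so [y = 0], and [a = b]. *)
Lemma positive_star_mul x : positive_elt (star x * x).
Proof.
set a := star x * x; have sa : selfadjoint a by exact: selfadjoint_star_mul.
have [b [pb bb cb]] := sqrt_exists (positive_sqr sa).
have sb := positive_selfadjoint pb.
have ab : GRing.comm a b by apply: cb; rewrite /GRing.comm mulrA.
set m := b - a; have sm : selfadjoint m by apply: selfadjointB.
have cmb : GRing.comm m b by apply/commr_sym/commrB => //; exact: commr_sym.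
set y := x * m.
have am : a * m = - (b * m).
  by rewrite !mulrBr bb ab opprB.
have yy : star y * y = - (m * b * m).
  by rewrite starM sm -!mulrA (mulrA (star x)) -/a am mulrN.
have pmb : positive_elt (m * b * m) by apply: positive_conj_comm.
have y0 : star y * y = 0.
  apply: positive_anti; last by rewrite yy opprK.
  apply: positive_swap; first exact: selfadjoint_star_mul.
  rewrite -(addKr (star y * y) (y * star y)) yy opprK addrC -yy.
  by apply: positiveD => //; exact: positive_starD.
have bm0 : b * m = 0.
  have [s [ps ss cs]] := sqrt_exists pb.
  have sm0 : s * m = 0.
    apply: star_mul_eq0; rewrite starM sm (positive_selfadjoint ps).
    by rewrite mulrA -(mulrA m) ss -[LHS]opprK -yy y0 oppr0.
  by rewrite -ss -mulrA sm0 mulr0.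
suff m0 : m = 0 by rewrite -[a](subKr b) -/m m0 subr0.
apply: star_mul_eq0; rewrite sm {1}/m mulrBl bm0 am bm0 oppr0 subr0 //.
Qed.

End Positive.

(** * The C*-algebra of 2 x 2 matrices *)

Section Columns.
Local Open Scope complex_scope.
Variables (R : realType) (B : cstarAlgType R).
Implicit Types (x y z : 'cV[B]_2) (a b : B) (S T : mxalg2 B) (r t : R).

Lemma positive_conj a b : positive_elt a -> positive_elt (star b * a * b).
Proof.
move=> /sqrt_exists[s [ps ss _]].
have -> : star b * a * b = star (s * b) * (s * b).
  by rewrite starM (positive_selfadjoint ps) -ss !mulrA.
exact: positive_star_mul.
Qed.

Definition col_inner x y : B := \sum_i star (x i ord0) * y i ord0.

Lemma column_normE x : column_norm x = Num.sqrt (cnorm (col_inner x x)).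
Proof. by []. Qed.

Lemma column_norm_ge0 x : 0 <= column_norm x.
Proof. exact: sqrtr_ge0. Qed.

Lemma column_norm_sqr x : column_norm x ^+ 2 = cnorm (col_inner x x).
Proof. by rewrite sqr_sqrtr // cnorm_ge0. Qed.

Lemma star_col_inner x y : star (col_inner x y) = col_inner y x.
Proof.
rewrite /col_inner (big_morph _ (@starD _ B) (@star0 _ B)).
by apply: eq_bigr => i _; rewrite starM starK.
Qed.

Lemma col_innerDr x y z : col_inner x (y + z) = col_inner x y + col_inner x z.
Proof.
by rewrite /col_inner -big_split; apply: eq_bigr => i _; rewrite mxE mulrDr.
Qed.

Lemma col_innerDl x y z : col_inner (y + z) x = col_inner y x + col_inner z x.
Proof. by rewrite -star_col_inner col_innerDr starD !star_col_inner. Qed.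

Definition col_mulr x a : 'cV[B]_2 := map_mx (fun b => b * a) x.

Lemma col_inner_mulr x y a : col_inner x (col_mulr y a) = col_inner x y * a.
Proof.
by rewrite /col_inner mulr_suml; apply: eq_bigr => i _; rewrite mxE mulrA.
Qed.

Lemma col_inner_mull x y a : col_inner (col_mulr x a) y = star a * col_inner x y.
Proof. by rewrite -star_col_inner col_inner_mulr starM star_col_inner. Qed.

Lemma positive_col_inner x : positive_elt (col_inner x x).
Proof.
rewrite /col_inner; elim/big_ind: _ => [|a b|i _]; first exact: positive0.
  exact: positiveD.
exact: positive_star_mul.
Qed.

Lemma cnorm_col_le x i : cnorm (x i ord0) <= column_norm x.
Proof.
rewrite -(ler_pXn2r (n := 2)) ?nnegrE ?cnorm_ge0 ?column_norm_ge0 //.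
rewrite column_norm_sqr -cnorm_starM; apply: cnorm_positive_mono.
  exact: positive_star_mul.
rewrite /col_inner (bigD1 i) //= addrAC subrr add0r.
elim/big_ind: _ => [|a b|j _]; first exact: positive0.
  exact: positiveD.
exact: positive_star_mul.
Qed.

Lemma column_norm_eq0 x : column_norm x = 0 -> x = 0.
Proof.
move=> x0; apply/matrixP => i j; rewrite mxE (ord1 j).
by apply: cnorm_eq0; apply/eqP; rewrite eq_le cnorm_ge0 -x0 cnorm_col_le.
Qed.

Lemma column_norm_le_sum x : column_norm x <= \sum_i cnorm (x i ord0).
Proof.
have s0 : 0 <= \sum_i cnorm (x i ord0) by apply: sumr_ge0 => i _; exact: cnorm_ge0.
rewrite -(ler_pXn2r (n := 2)) ?nnegrE ?column_norm_ge0 // column_norm_sqr.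
rewrite /col_inner !big_ord_recl !big_ord0 !addr0.
apply: le_trans (ler_cnormD _ _) _; rewrite !cnorm_starM.
have := cnorm_ge0 (x ord0 ord0); have := cnorm_ge0 (x (lift ord0 ord0) ord0); nra.
Qed.

(** The Cauchy-Schwarz inequality: with [a = <x, y>] and [t = |<x, x>|], the
    positive element [<z, z>] for [z = x a - t y] is at most
    [t (t <y, y> - a^* a)]. *)
Lemma col_cauchy_schwarz x y :
  cnorm (col_inner x y) <= column_norm x * column_norm y.
Proof.
set a := col_inner x y; set t := cnorm (col_inner x x).
have t0 : 0 <= t by exact: cnorm_ge0.
have [te|tn] := eqVneq t 0.
  have -> : a = 0.
    rewrite /a (_ : x = 0); last by apply: column_norm_eq0; rewrite column_normE -/t te sqrtr0.
    by rewrite /col_inner big1 // => i _; rewrite mxE star0 mul0r.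
  by rewrite cnorm0 mulr_ge0 ?column_norm_ge0.
have tp : 0 < t by rewrite lt_neqAle eq_sym tn.
set b := t%:C *: (1 : B).
have pz := positive_col_inner (col_mulr x a + col_mulr y (- b)).
have pa : positive_elt (star a * (t%:C *: 1 - col_inner x x) * a).
  apply: positive_conj; apply: positive_normB => //.
  exact/positive_selfadjoint/positive_col_inner.
have := positiveD pz pa.
rewrite !col_innerDl !col_innerDr !col_inner_mull !col_inner_mulr starN star_realZ.
rewrite star1 -/b -(star_col_inner x y) -/a.
have -> : star a * (col_inner x x * a) + star a * (a * - b) +
   (- b * (star a * a) + - b * (col_inner y y * - b)) +
   star a * (b - col_inner x x) * a = t%:C *: (t%:C *: col_inner y y - star a * a).
  rewrite /b !(mulrN, mulNr, opprK) -!scalerAl -!scalerAr !mul1r !mulr1.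
  rewrite mulrBr mulrBl -!scalerAr mulr1 -!scalerAl !mulrA scalerBr scalerA.
  move: (star a * col_inner x x * a) (star a * a) (col_inner y y) => p q v.
  rewrite !addrA. 
  by rewrite (ACl (4*3*(5*2)*(1*6)))%AC /= !subrr !addr0.
move=> pos.
have pos' : positive_elt (t%:C *: col_inner y y - star a * a).
  have := positiveZ (_ : 0 <= t^-1) pos; rewrite scalerA -rmorphM mulVf // scale1r.
  by apply; rewrite invr_ge0.
have := cnorm_positive_mono (positive_star_mul a) pos'.
rewrite cnorm_starM cnormZr ger0_norm // -column_norm_sqr /t -column_norm_sqr.
rewrite -exprMn ler_pXn2r ?nnegrE ?cnorm_ge0 ?mulr_ge0 ?column_norm_ge0 //.
Qed.

Lemma column_normD x y : column_norm (x + y) <= column_norm x + column_norm y.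
Proof.
rewrite -(ler_pXn2r (n := 2)) ?nnegrE ?addr_ge0 ?column_norm_ge0 //.
rewrite column_norm_sqr col_innerDl !col_innerDr.
apply: le_trans (ler_cnormD _ _) _.
have h1 := ler_cnormD (col_inner x x) (col_inner x y).
have h2 := ler_cnormD (col_inner y x) (col_inner y y).
have h3 := col_cauchy_schwarz x y; have h4 := col_cauchy_schwarz y x.
apply: le_trans (lerD h1 h2) _; rewrite -!column_norm_sqr sqrrD; lra.
Qed.

Lemma Re_norm_ge0 (c : R[i]) : 0 <= complex.Re `|c|.
Proof. by have := normr_ge0 c; rewrite lecE /= => /andP[]. Qed.

Lemma column_normZ (c : R[i]) x :
  column_norm (map_mx (fun b => c *: b) x) = complex.Re `|c| * column_norm x.
Proof.
have c0 := Re_norm_ge0 c.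
have -> : map_mx (fun b => c *: b) x = col_mulr x (c *: 1).
  by apply/matrixP => i j; rewrite !mxE -scalerAr mulr1.
apply/eqP; rewrite -(eqrXn2 (n := 2)) ?mulr_ge0 ?column_norm_ge0 //.
rewrite column_norm_sqr col_inner_mull col_inner_mulr starZ star1 -scalerAr mulr1.
rewrite -scalerAl mul1r.
rewrite scalerA cnormZ normrM norm_conjC exprMn column_norm_sqr.
by rewrite normc_def -rmorphM /= -expr2.
Qed.

Lemma col_inner_mulmx T x y : col_inner x (T *m y) = col_inner (star T *m x) y.
Proof.
rewrite /col_inner.
under eq_bigr do rewrite mxE mulr_sumr.
rewrite exchange_big; apply: eq_bigr => j _ /=.
rewrite mxE (big_morph _ (@starD _ B) (@star0 _ B)) mulr_suml.
by apply: eq_bigr => i _; rewrite !mxE starM starK mulrA.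
Qed.

Lemma mulmx_column_bound T x :
  column_norm (T *m x) <= (\sum_i \sum_j cnorm (T i j)) * column_norm x.
Proof.
apply: le_trans (column_norm_le_sum _) _; rewrite mulr_suml.
apply: ler_sum => i _; rewrite mxE mulr_suml.
apply: (le_trans (y := \sum_j cnorm (T i j * x j ord0))).
  elim/big_ind2: _ => [|a r b t ar bt|j _] //; first by rewrite cnorm0.
  by apply: le_trans (ler_cnormD _ _) _; apply: lerD.
apply: ler_sum => j _; apply: le_trans (ler_cnormM _ _) _.
by apply: ler_wpM2l; [exact: cnorm_ge0|exact: cnorm_col_le].
Qed.

Lemma column_norm0 : column_norm (0 : 'cV[B]_2) = 0.
Proof.
rewrite column_normE /col_inner big1 ?cnorm0 ?sqrtr0 // => i _.
by rewrite !mxE mulr0.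
Qed.

Lemma mulmx_opnorm_le T x : column_norm (T *m x) <= mx_opnorm T * column_norm x.
Proof.
have [x0|x0] := eqVneq (column_norm x) 0.
  by rewrite (column_norm_eq0 x0) mulmx0 column_norm0 mulr0.
have xp : 0 < column_norm x by rewrite lt_neqAle eq_sym x0 column_norm_ge0.
rewrite -ler_pdivrMr //.
set c : R[i] := (column_norm x)^-1%:C.
have cE : complex.Re `|c| = (column_norm x)^-1.
  by rewrite normc_def /= expr0n addr0 sqrtr_sqr ger0_norm // invr_ge0 ltW.
have -> : column_norm (T *m x) / column_norm x =
    column_norm (T *m map_mx (fun b => c *: b) x).
  have -> : T *m map_mx (fun b => c *: b) x = map_mx (fun b => c *: b) (T *m x).
    apply/matrixP => i j; rewrite !mxE scaler_sumr; apply: eq_bigr => k _.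
    by rewrite mxE scalerAr.
  by rewrite column_normZ cE mulrC.
apply: ub_le_sup.
  exists (\sum_i \sum_j cnorm (T i j)) => _ [y /= y1 <-].
  apply: le_trans (mulmx_column_bound _ _) _; apply: ler_piMr => //.
  by do 2!(apply: sumr_ge0 => ? _); exact: cnorm_ge0.
by eexists; [|reflexivity]; rewrite /= column_normZ cE mulVf.
Qed.

Lemma mx_opnorm_le T r : 0 <= r ->
  (forall x, column_norm (T *m x) <= r * column_norm x) -> mx_opnorm T <= r.
Proof.
move=> r0 Tr; apply: ge_sup.
  by exists (column_norm (T *m 0)), 0 => //=; rewrite column_norm0.
move=> _ [x /= x1 <-]; apply: le_trans (Tr x) _; exact: ler_piMr.
Qed.

Lemma column_norm_delta i : column_norm (delta_mx i ord0 : 'cV[B]_2) = 1.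
Proof.
rewrite column_normE /col_inner (bigD1 i) //= big1 => [|j ji].
  by rewrite !mxE !eqxx star1 mulr1 addr0 cnorm1 sqrtr1.
by rewrite !mxE (negbTE ji) mulr0.
Qed.

Lemma mx_opnorm_ge0 T : 0 <= mx_opnorm T.
Proof.
have := mulmx_opnorm_le T (delta_mx ord0 ord0).
by rewrite column_norm_delta mulr1; apply: le_trans; exact: column_norm_ge0.
Qed.

Lemma cnorm_entry_le T i j : cnorm (T i j) <= mx_opnorm T.
Proof.
have := mulmx_opnorm_le T (delta_mx j ord0); rewrite column_norm_delta mulr1.
apply: le_trans; apply: le_trans (cnorm_col_le _ i).
by rewrite -colE mxE.
Qed.

Lemma mx_opnorm_le_sum T : mx_opnorm T <= \sum_i \sum_j cnorm (T i j).
Proof.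
apply: mx_opnorm_le => [|x]; last exact: mulmx_column_bound.
by do 2!(apply: sumr_ge0 => ? _); exact: cnorm_ge0.
Qed.

Lemma mx_opnorm_eq0 T : mx_opnorm T = 0 -> T = 0.
Proof.
move=> T0; apply/matrixP => i j; rewrite mxE; apply: cnorm_eq0; apply/eqP.
by rewrite eq_le cnorm_ge0 andbT -T0 cnorm_entry_le.
Qed.

Lemma mx_opnormD S T : mx_opnorm (S + T) <= mx_opnorm S + mx_opnorm T.
Proof.
apply: mx_opnorm_le => [|x]; first by rewrite addr_ge0 ?mx_opnorm_ge0.
rewrite mulmxDl mulrDl; apply: le_trans (column_normD _ _) _.
by apply: lerD; exact: mulmx_opnorm_le.
Qed.

Lemma mx_opnormZ_le (c : R[i]) T :
  mx_opnorm (c *: T) <= complex.Re `|c| * mx_opnorm T.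
Proof.
apply: mx_opnorm_le => [|x]; first by rewrite mulr_ge0 ?mx_opnorm_ge0 ?Re_norm_ge0.
have -> : (c *: T) *m x = map_mx (fun b => c *: b) (T *m x).
  apply/matrixP => i j; rewrite !mxE scaler_sumr; apply: eq_bigr => k _.
  by rewrite mxE scalerAl.
by rewrite column_normZ -mulrA ler_wpM2l ?Re_norm_ge0 // mulmx_opnorm_le.
Qed.

Lemma mx_opnormZ (c : R[i]) T : mx_opnorm (c *: T) = complex.Re `|c| * mx_opnorm T.
Proof.
apply/eqP; rewrite eq_le mx_opnormZ_le andTb.
have [->|c0] := eqVneq c 0; first by rewrite normr0 mul0r mx_opnorm_ge0.
have := mx_opnormZ_le c^-1 (c *: T); rewrite scalerA mulVf // scale1r.
have cc : complex.Re `|c| * complex.Re `|c^-1| = 1.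
  have := cnormZ c (c^-1 *: (1 : B)).
  by rewrite scalerA mulfV // scale1r cnormZ cnorm1 mulr1.
move=> /(ler_wpM2l (Re_norm_ge0 c)); by rewrite mulrA cc mul1r.
Qed.

Lemma mx_opnormM S T : mx_opnorm (S * T) <= mx_opnorm S * mx_opnorm T.
Proof.
apply: mx_opnorm_le => [|x]; first by rewrite mulr_ge0 ?mx_opnorm_ge0.
rewrite -mulmxA -mulrA; apply: le_trans (mulmx_opnorm_le _ _) _.
by apply: ler_wpM2l; rewrite ?mx_opnorm_ge0 ?mulmx_opnorm_le.
Qed.

Lemma mx_opnorm_star_le T : mx_opnorm (star T) <= mx_opnorm T.
Proof.
apply: mx_opnorm_le => [|x]; first exact: mx_opnorm_ge0.
have [->|y0] := eqVneq (column_norm (star T *m x)) 0.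
  by rewrite mulr_ge0 ?mx_opnorm_ge0 ?column_norm_ge0.
have yp : 0 < column_norm (star T *m x) by rewrite lt_neqAle eq_sym y0 column_norm_ge0.
rewrite -(ler_pM2r yp) -expr2 column_norm_sqr col_inner_mulmx starK.
apply: le_trans (col_cauchy_schwarz _ _) _.
rewrite [leRHS]mulrAC ler_wpM2r ?column_norm_ge0 //.
exact: mulmx_opnorm_le.
Qed.

Lemma mx_opnorm_starM T : mx_opnorm (star T * T) = mx_opnorm T ^+ 2.
Proof.
apply/eqP; rewrite eq_le; apply/andP; split.
  apply: le_trans (mx_opnormM _ _) _; rewrite expr2.
  by rewrite ler_wpM2r ?mx_opnorm_ge0 ?mx_opnorm_star_le.
have n0 := mx_opnorm_ge0 (star T * T).
rewrite -[leRHS]sqr_sqrtr // ler_pXn2r ?nnegrE ?mx_opnorm_ge0 ?sqrtr_ge0 //.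
apply: mx_opnorm_le => [|x]; first exact: sqrtr_ge0.
rewrite -(ler_pXn2r (n := 2)) ?nnegrE ?mulr_ge0 ?column_norm_ge0 ?sqrtr_ge0 //.
rewrite exprMn column_norm_sqr (sqr_sqrtr n0) col_inner_mulmx mulmxA.
apply: le_trans (col_cauchy_schwarz _ _) _; rewrite expr2 mulrA.
by apply: ler_wpM2r; [exact: column_norm_ge0|exact: mulmx_opnorm_le].
Qed.

(** The operator norm is equivalent to the sum of the norms of the entries. *)
Lemma mx_opnorm_complete (u : nat -> mxalg2 B) :
  (forall e : R, 0 < e -> exists N, forall m n,
     (N <= m)%N -> (N <= n)%N -> mx_opnorm (u m - u n) < e) ->
  exists l : mxalg2 B, (fun n => mx_opnorm (u n - l)) @ \oo --> (0 : R).
Proof.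
move=> cu; have cl (ij : 'I_2 * 'I_2) :
    exists l, tendsto (fun n => u n ij.1 ij.2) l.
  apply: cauchy_tendsto => e /cu[N HN]; exists N => m n Nm Nn.
  apply: le_lt_trans (HN m n Nm Nn).
  by have := cnorm_entry_le (u m - u n) ij.1 ij.2; rewrite !mxE.
have [l Hl] := choice cl; exists (\matrix_(i, j) l (i, j)).
set L : mxalg2 B := \matrix_(i, j) _.
refine (@squeeze_cvgr _ _ _ _ (fun=> 0)
  (fun n => \sum_i \sum_j cnorm ((u n - L) i j)) _ _ _ _ _); last first.
- under eq_fun do rewrite !big_ord_recl !big_ord0 !addr0.
  have Hc i j : (fun n => cnorm ((u n - L) i j)) @ \oo --> (0 : R).
    by have := Hl (i, j); rewrite /tendsto; under [in X in _ -> X]eq_fun do rewrite !mxE.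
  have -> : (0 : R) = 0 + 0 + (0 + 0) by rewrite !addr0.
  by apply: cvgD; apply: cvgD.
- exact: cvg_cst.
by near=> n; rewrite mx_opnorm_ge0 mx_opnorm_le_sum.
Unshelve. all: by end_near. Qed.

HB.instance Definition _ := StarAlgebra_isCStarAlgebra.Build R (mxalg2 B)
  mx_opnorm_eq0 mx_opnormD mx_opnormZ mx_opnormM mx_opnorm_starM
  mx_opnorm_complete.

End Columns.

(** * Polar decomposition and range projections *)

Section Polar.
Local Open Scope complex_scope.
Variables (R : realType) (A : cstarAlgType R).
Implicit Types (x y z a b s t p q e u : A) (r : R).

Notation closure_range t := (norm_closure (@cnorm R A) (op_range t)).

Lemma sqrt_eltP a : positive_elt a -> sqrt_spec a (sqrt_elt a).
Proof.
move=> /sqrt_exists[s [ps ss _]].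
by apply: (@xgetPex _ (0 : A) [set s | sqrt_spec a s]); exists s; split.
Qed.

Lemma sqrt_elt_selfadjoint a : selfadjoint (sqrt_elt a).
Proof.
rewrite /sqrt_elt; case: xgetP => [s _ [ps _]|_]; last exact: star0.
exact: positive_selfadjoint.
Qed.

Lemma sqrt_elt_comm a b : positive_elt a -> GRing.comm b a ->
  GRing.comm b (sqrt_elt a).
Proof. by move=> pa; have [ps ss] := sqrt_eltP pa; exact: sqrt_unique. Qed.

Lemma abs_sqr t : abs_elt t * abs_elt t = star t * t.
Proof. by have [_] := sqrt_eltP (positive_star_mul t). Qed.

Lemma abs_selfadjoint t : selfadjoint (abs_elt t).
Proof. exact: sqrt_elt_selfadjoint. Qed.

Lemma cnorm_abs_mul t x : cnorm (abs_elt t * x) = cnorm (t * x).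
Proof.
apply/eqP; rewrite -(eqrXn2 (n := 2)) ?cnorm_ge0 // -!cnorm_starM !starM.
by rewrite abs_selfadjoint !mulrA -(mulrA (star x) _ t) -abs_sqr !mulrA.
Qed.

Lemma closure_rangeP t x :
  closure_range t x <-> exists v, tendsto (fun n => t * v n) x.
Proof.
split=> [/norm_closureP[w [wt wx]]|[v vx]].
  have [v Hv] := choice (fun n => let: ex_intro2 y _ yw := wt n in ex_intro _ y yw).
  by exists v; under eq_fun do rewrite Hv.
by apply/norm_closureP; exists (fun n => t * v n); split=> [n|//]; exists (v n).
Qed.

Lemma closure_range_mul t x y : closure_range t x -> closure_range t (x * y).
Proof.
move=> /closure_rangeP[v vx]; apply/closure_rangeP; exists (fun n => v n * y).
under eq_fun do rewrite mulrA.
exact: tendstoM vx (tendsto_cst y).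
Qed.

Lemma closure_range_trans s t x :
  closure_range s t -> closure_range t x -> closure_range s x.
Proof.
move=> st tx r r0; have r2 : 0 < r / 2 by rewrite divr_gt0.
have [_ [y _ <-] xy] := tx _ r2.
have [_ [z _ <-] yz] := closure_range_mul y st r2.
exists (s * z); first by exists z.
rewrite -(subrKA (t * y)) [r]splitr; apply: le_lt_trans (ler_cnormD _ _) _.
exact: ltrD.
Qed.

Lemma closure_range_self t : closure_range t t.
Proof.
by move=> r r0; exists (t * 1); [exists 1|rewrite mulr1 subrr cnorm0].
Qed.

Lemma closure_rangeM t x : closure_range t (t * x).
Proof. exact/closure_range_mul/closure_range_self. Qed.

Lemma closure_range_fixed t p x : p * t = t -> closure_range t x -> p * x = x.
Proof.
move=> pt /closure_rangeP[v vx].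
apply: (tendsto_unique _ vx); have := tendstoM (tendsto_cst p) vx.
by under eq_fun do rewrite mulrA pt.
Qed.

(** With [a = t t^*] and [c = r (r + a)^-1], the distance from [t] to
    [t t^* (r + a)^-1 t] is the norm of [c t], and [(c t) (c t)^* = r c (1 - c)]
    is at most [r / 4], the difference being [(r / 4) (1 - 2 c)^2]. *)
Lemma closure_range_mul_star t : closure_range (t * star t) t.
Proof.
move=> eps eps0; set a := t * star t.
have pa : positive_elt a by rewrite /a -{1}(starK t); exact: positive_star_mul.
have sa := positive_selfadjoint pa.
set r := eps ^+ 2; have r0 : 0 < r by rewrite exprn_gt0.
have [b [rab bra]] := positive_invertible pa r0.
have sb : selfadjoint b.
  have : star b * star (r%:C *: 1 + a) = 1 by rewrite -starM rab star1.
  rewrite (selfadjointD (selfadjoint_real A r) sa) => e.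
  by rewrite /selfadjoint -[LHS]mulr1 -rab mulrA e mul1r.
set c := r%:C *: b; have sc : selfadjoint c by exact: selfadjointZ.
have ab : a * b = 1 - c.
  by apply/eqP; rewrite eq_sym subr_eq -rab mulrDl -scalerAl mul1r addrC.
exists (a * (b * t)); first by exists (b * t).
have -> : t - a * (b * t) = c * t.
  by rewrite mulrA ab mulrBl mul1r subKr.
set d := c * t; have dd : d * star d = r%:C *: (c * (1 - c)).
  rewrite /d starM sc -ab mulrA -(mulrA c) -/a.
  by rewrite -[X in _ * X = _]/(r%:C *: b) -scalerAr -mulrA.
have bound : cnorm d ^+ 2 <= r / 4.
  rewrite -cnorm_star -cnorm_starM starK; apply: cnorm_le_positive.
  - by rewrite divr_ge0 // ltW.
  - by rewrite -{1}(starK d); exact: positive_star_mul.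
  have -> : (r / 4)%:C *: 1 - d * star d =
      (r / 4)%:C *: ((1 - 2%:C *: c) * (1 - 2%:C *: c)).
    have sq4 (f : A) : (1 - 2%:C *: f) * (1 - 2%:C *: f) = 1 - 4%:C *: (f * (1 - f)).
      rewrite mulrBl mul1r !mulrBr !mulr1 -scalerAl -scalerAr scalerA.
      have -> : 4%:C = 2%:C + 2%:C :> R[i] by rewrite -rmorphD; congr (_%:C); ring.
      have -> : 2%:C * 2%:C = 2%:C + 2%:C :> R[i].
        by rewrite -rmorphM -rmorphD; congr (_%:C); ring.
      rewrite scalerBr !opprB -addrA; congr (_ + _).
      by rewrite addrCA; congr (_ + _); rewrite scalerDl opprD.
    by rewrite sq4 scalerBr scalerA -rmorphM mulfVK // dd.
  apply: positiveZ; first by rewrite divr_ge0 // ltW.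
  apply: positive_sqr; apply: selfadjointB; first exact: selfadjoint1.
  exact: selfadjointZ.
have := cnorm_ge0 d; rewrite /r in bound; nra.
Qed.

(** [closure_range t = q A], in a form that can be verified on [q] and [t] alone. *)
Definition range_projection t q :=
  [/\ projection q, closure_range t q & q * t = t].

Lemma range_projection_onto t q :
  range_projection t q -> projection_onto (closure_range t) q.
Proof.
move=> [pq cq qt]; split=> //; apply/seteqP; split=> x.
  by move=> [y _ <-]; exact: closure_range_mul.
by move=> /(closure_range_fixed qt) qx; exists x.
Qed.

Lemma range_projection_complemented t q :
  range_projection t q -> orth_complemented (closure_range t).
Proof.
move=> [[sq qq] cq qt]; apply/seteqP; split=> // x _.
exists (q * x); first exact: closure_range_mul.
exists ((1 - q) * x); last by rewrite mulrBl mul1r addrC subrK.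
move=> m /(closure_range_fixed qt) <-; rewrite /inner starM sq -mulrA.
by rewrite (mulrA q) mulrBr mulr1 qq subrr mul0r mulr0.
Qed.

(** [q = u u^*], because [u t^* = u |t| u^* = t u^*]. *)
Lemma polar_range_projection t : has_polar_decomposition (@cnorm R A) t ->
  exists q, range_projection t q.
Proof.
move=> [_ [u [uu tu [[se ee] reM]]]]; set e := star u * u in se ee reM.
have ct : closure_range (star t) e by rewrite -reM; exists 1 => //; rewrite mulr1.
have eu : e * star u = star u by rewrite -[RHS](starK _) -{2}uu !starM !starK mulrA.
have uts : u * star t = t * star u.
  by rewrite {1}tu starM abs_selfadjoint mulrA -tu.
exists (u * star u); split.
- by split; [rewrite /selfadjoint starM starK|rewrite mulrA uu].
- have -> : u * star u = u * e * star u by rewrite -mulrA eu.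
  move: ct => /closure_rangeP[v vx]; apply: closure_range_mul.
  apply/closure_rangeP; exists (fun n => star u * v n).
  under eq_fun do rewrite mulrA -uts -mulrA.
  exact: tendstoM (tendsto_cst u) vx.
- by rewrite {1}tu mulrA uu -tu.
Qed.

(** If [|t| x_n] tends to the range projection [e] of [t^*], then [t x_n]
    converges, because [|t x| = ||t| x|]; its limit is the partial isometry. *)
Lemma range_projection_polar t e : range_projection (star t) e ->
  has_polar_decomposition (@cnorm R A) t.
Proof.
move=> re; split; first exact: range_projection_complemented re.
have [pe ce et] := re; have [se ee] := pe.
set m := abs_elt t; have sm : selfadjoint m := abs_selfadjoint t.
have em : e * m = m.
  have m0 : m * (1 - e) = 0.
    apply: star_mul_eq0; rewrite starM sm mulrA -(mulrA _ m m) (abs_sqr t : m * m = _) starB star1 se.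
    by rewrite mulrA mulrBl mul1r et subrr !mul0r.
  have := congr1 star m0; rewrite starM starB star1 se sm star0 mulrBl mul1r.
  by move/eqP; rewrite subr_eq0 => /eqP.
have cm : closure_range m e.
  apply: closure_range_trans ce.
  apply: closure_range_trans (closure_range_mul_star (star t)).
  by rewrite starK -abs_sqr; exact: closure_rangeM.
have [x mx] : exists x : nat -> A, tendsto (fun n => m * x n) e by apply/closure_rangeP.
have [|u tu] := @cauchy_tendsto _ _ (fun n => t * x n).
  move=> r r0; have [|N HN] := tendsto_near mx (e := r / 2); first by rewrite divr_gt0.
  exists N => i j Ni Nj; rewrite -mulrBr -cnorm_abs_mul mulrBr -(subrKA e).
  apply: le_lt_trans (ler_cnormD _ _) _; rewrite [r]splitr ltrD ?HN //.
  by rewrite cnormB HN.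
have uu : star u * u = e.
  apply: (tendsto_unique (tendstoM (tendsto_star tu) tu)).
  have := tendstoM (tendsto_star mx) mx; rewrite se ee; congr (tendsto _ _).
  apply/funext => n; rewrite !starM sm !mulrA -(mulrA _ m m) -(mulrA _ (star t)).
  by rewrite -abs_sqr.
have ue : u * e = u.
  apply/eqP; rewrite eq_sym -subr_eq0; apply/eqP/star_mul_eq0.
  have -> : u - u * e = u * (1 - e) by rewrite mulrBr mulr1.
  rewrite starM mulrA -(mulrA _ (star u)) uu starB star1 se.
  by rewrite mulrBl mul1r ee subrr mul0r.
exists u; split; first by rewrite /partial_isometry -mulrA uu.
- have c1 := tendstoM tu (tendsto_cst m); apply: (tendsto_unique _ c1).
  have c2 := tendstoM mx (tendsto_cst m); rewrite em in c2.
  rewrite /tendsto; suff -> : (fun n => cnorm (t * x n * m - t)) =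
    (fun n => cnorm (m * x n * m - m)) by [].
  apply/funext => n; rewrite -[X in _ - X]mulr1 -[X in _ = cnorm (_ - X)]mulr1.
  by rewrite -!mulrA -!mulrBr -cnorm_abs_mul.
- by rewrite uu; exact: range_projection_onto.
Qed.

(** For the converse, the polar decomposition of [t^*] turns the projection for
    [t] into one for [t^*]. *)
Lemma polarP t : has_polar_decomposition (@cnorm R A) t <->
  exists q, range_projection t q.
Proof.
split; first exact: polar_range_projection.
move=> [q rq]; have := @range_projection_polar (star t) q.
rewrite starK => /(_ rq)/polar_range_projection[e re].
exact: range_projection_polar re.
Qed.

End Polar.

Section RangeProjection.
Variables (R : realType) (A : cstarAlgType R).
Implicit Types (d k t p q : A).

Lemma range_projection_mul_star t q :
  range_projection (t * star t) q <-> range_projection t q.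
Proof.
split=> -[pq cq qt]; split=> //.
- by apply: closure_range_trans cq; exact: closure_rangeM.
- exact: closure_range_fixed qt (closure_range_mul_star t).
- exact: closure_range_trans (closure_range_mul_star t) cq.
- by rewrite mulrA qt.
Qed.

Lemma range_projection_mul_invertible d k q : invertible k ->
  range_projection (d * k) q <-> range_projection d q.
Proof.
move=> [k' [kk' k'k]].
have dE : d = d * k * k' by rewrite -mulrA kk' mulr1.
split=> -[pq cq qt]; split=> //.
- by apply: closure_range_trans cq; exact: closure_rangeM.
- by rewrite dE mulrA qt.
- by apply: closure_range_trans cq; rewrite {2}dE; exact: closure_rangeM.
- by rewrite mulrA qt.
Qed.

(** If [1 = p + n] with [p] in the closed range and [n] in the kernel of a
    self-adjoint [d], then [n^* p = 0], hence [p^* p = p]. *)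
Lemma range_kernel_decompositionP d : selfadjoint d ->
  set_sum (norm_closure (@cnorm R A) (op_range d)) (op_kernel d) 1 <->
  exists p, range_projection d p.
Proof.
move=> sd; split=> [[p cp [n /= dn pn]]|[p [[sp pp] cp pd]]]; last first.
  exists p => //; exists (1 - p); last by rewrite addrC subrK.
  have := congr1 star pd; rewrite starM sd sp => dp.
  by rewrite /op_kernel /= mulrBr mulr1 dp subrr.
have np : star n * p = 0.
  have fix_d : (1 - star n) * d = d.
    by rewrite mulrBl mul1r -{2}sd -starM dn star0 subr0.
  have := closure_range_fixed fix_d cp; rewrite mulrBl mul1r => /eqP.
  by rewrite -subr_eq0 addrAC subrr add0r oppr_eq0 => /eqP.
have pE : star p * p = p.
  have -> : star p = 1 - star n by rewrite -star1 -pn starD addrK.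
  by rewrite mulrBl mul1r np subr0.
have sp : selfadjoint p by rewrite -pE; exact: selfadjoint_star_mul.
exists p; split=> //; first by split; rewrite // -{1}sp.
have dp : d * p = d.
  have -> : p = 1 - n by rewrite -pn addrK.
  by rewrite mulrBr mulr1 dn subr0.
by rewrite -{1}sd -{1}sp -starM dp.
Qed.

End RangeProjection.

(** * The quasi-projection pair *)

Section Corner.
Variables (R : realType) (B : cstarAlgType R).
Implicit Types (g p x : B) (q T : mxalg2 B).

Definition corner (i : 'I_2) x : mxalg2 B :=
  \matrix_(j, k) if (j == i) && (k == i) then x else 0.

Lemma cornerM i x y : corner i x * corner i y = corner i (x * y).
Proof.
apply/matrixP => j k; rewrite !mxE (bigD1 i) //= big1 => [|l li].
  rewrite !mxE eqxx andbT addr0 /=.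
  by case: (j == i); case: (k == i); rewrite ?mulr0 ?mul0r.
by rewrite !mxE (negbTE li) andbF mul0r.
Qed.

Lemma star_corner i x : star (corner i x) = corner i (star x).
Proof. by apply/matrixP => j k; rewrite !mxE andbC; case: ifP; rewrite ?star0. Qed.

Lemma corner_mul_entry i x T : (corner i x * T) i i = x * T i i.
Proof.
rewrite !mxE (bigD1 i) //= big1 => [|l li]; first by rewrite !mxE eqxx addr0.
by rewrite !mxE (negbTE li) andbF mul0r.
Qed.

Lemma mul_corner_entry i x T : (T * corner i x) i i = T i i * x.
Proof.
rewrite !mxE (bigD1 i) //= big1 => [|l li]; first by rewrite !mxE eqxx addr0.
by rewrite !mxE (negbTE li) mulr0.
Qed.

Lemma cnorm_corner_le i x : cnorm (corner i x) <= cnorm x.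
Proof.
apply: le_trans (mx_opnorm_le_sum _) _.
rewrite (bigD1 i) //= (bigD1 i) //= !big1 ?addr0 => [|j ji|j ji].
- by rewrite mxE eqxx.
- by rewrite big1 // => k _; rewrite mxE (negbTE ji) cnorm0.
- by rewrite mxE (negbTE ji) andbF cnorm0.
Qed.

Lemma cornerB i x y : corner i x - corner i y = corner i (x - y).
Proof. by apply/matrixP => j k; rewrite !mxE; case: ifP; rewrite ?subr0. Qed.

(** A projection [q] for the corner need not itself be a corner a priori, but its
    [(i, i)] entry is a projection for [g]: it is self-adjoint, fixes [g] from
    the left and lies in the closed range of [g], so it is idempotent. *)
Lemma range_projection_corner i g :
  (exists q, range_projection (corner i g) q) <-> exists p, range_projection g p.
Proof.
split=> [[q [[sq qq] cq qg]]|[p [[sp pp] cp pg]]].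
  have pg : q i i * g = g.
    have := congr1 (fun T : mxalg2 B => T i i) qg.
    by rewrite mul_corner_entry mxE eqxx.
  have cp : norm_closure (@cnorm R B) (op_range g) (q i i).
    move=> e /cq[_ [T _ <-] qT]; exists (g * T i i); first by exists (T i i).
    apply: le_lt_trans qT; apply: le_trans (cnorm_entry_le _ i i).
    by rewrite -corner_mul_entry !mxE.
  exists (q i i); split=> //; split; last exact: closure_range_fixed pg cp.
  by rewrite /selfadjoint -{2}sq !mxE.
exists (corner i p); split.
- by split; rewrite /selfadjoint ?star_corner ?sp // cornerM pp.
- move=> e /cp[_ [x _ <-] px]; exists (corner i g * corner i x); first by exists (corner i x).
  by rewrite cornerM cornerB; apply: le_lt_trans px; exact: cnorm_corner_le.
- by rewrite cornerM pg.
Qed.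

End Corner.

Section Matrix22.
Variables (C : numClosedFieldType) (B : starAlgType C).
Implicit Types a b c d : B.

Lemma ord2P (P : 'I_2 -> Prop) : P ord0 -> P (lift ord0 ord0) -> forall i, P i.
Proof.
move=> P0 P1 i; have [->//|] := eqVneq i ord0; case: (unliftP ord0 i) => [j ->|->].
  by rewrite (ord1 j).
by rewrite eqxx.
Qed.

Lemma mx22M a b c d a' b' c' d' : mx22 a b c d * mx22 a' b' c' d' =
  mx22 (a * a' + b * c') (a * b' + b * d') (c * a' + d * c') (c * b' + d * d').
Proof.
apply/matrixP; apply: ord2P; apply: ord2P;
  by rewrite !mxE !big_ord_recl big_ord0 addr0 !mxE.
Qed.

Lemma mx22D a b c d a' b' c' d' : mx22 a b c d + mx22 a' b' c' d' =
  mx22 (a + a') (b + b') (c + c') (d + d').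
Proof. by apply/matrixP; apply: ord2P; apply: ord2P; rewrite !mxE. Qed.

Lemma mx22N a b c d : - mx22 a b c d = mx22 (- a) (- b) (- c) (- d).
Proof. by apply/matrixP; apply: ord2P; apply: ord2P; rewrite !mxE. Qed.

Lemma star_mx22 a b c d : star (mx22 a b c d) = mx22 (star a) (star c) (star b) (star d).
Proof. by apply/matrixP; apply: ord2P; apply: ord2P; rewrite !mxE. Qed.

Lemma mx22_1 : 1 = mx22 1 0 0 1 :> mxalg2 B.
Proof. by apply/matrixP; apply: ord2P; apply: ord2P; rewrite !mxE. Qed.

End Matrix22.

Section Pair.
Local Open Scope complex_scope.
Variables (R : realType) (B : cstarAlgType R) (A : B).
Variables (hA : selfadjoint A) (hpos : positive_elt (A * A - A)).

Let ell : B := sqrt_elt (A * A - A).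
Let P : mxalg2 B := mx22 1 0 0 0.
Let Q : mxalg2 B := mx22 A (- ell) ell (1 - A).

Let sell : selfadjoint ell := sqrt_elt_selfadjoint _.

Let ell_sqr : ell * ell = A * A - A.
Proof. by have [_] := sqrt_eltP hpos. Qed.

Let A_ell : A * ell = ell * A.
Proof.
apply: sqrt_elt_comm => //; apply: commrB; last exact: commr_refl.
by apply: commrM; exact: commr_refl.
Qed.

Let s1A : star (1 - A) = 1 - A.
Proof. by rewrite starB star1 hA. Qed.

Lemma quasi_pair : quasi_projection_pair P Q.
Proof.
have PE : 1 - P = mx22 0 0 0 1.
  by rewrite mx22_1 mx22N mx22D !subr0 subrr.
have simp := (mulr0, mul0r, mulr1, mul1r, addr0, add0r, oppr0).
rewrite /quasi_projection_pair PE /P /Q star_mx22 !mx22M !mx22N hA s1A starN sell !simp.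
split=> //; first split.
- by rewrite /selfadjoint star_mx22 star1 !star0.
- by rewrite mx22M !simp.
- rewrite /idempotent_elt mx22M; congr mx22.
  + by rewrite mulNr ell_sqr opprB addrC subrK.
  + by rewrite mulrN mulNr mulrBr mulr1 A_ell opprB addKr.
  + by rewrite mulrBl mul1r A_ell addrC subrK.
  + rewrite mulrN ell_sqr opprB mulrBl mul1r mulrBr mulr1 opprB.
    by rewrite !addrA [LHS](ACl (3*4*(1*6)*(5*2)))%AC /= !subrr !addr0.
- by rewrite opprK.
Qed.

Let D := A - 1.
Let K := A + A - 1.

Let DK : (1 - A) * (1 - A) + ell * ell = D * K.
Proof.
rewrite ell_sqr /D /K mulrBl mul1r mulrBr mulr1 mulrBl mul1r mulrBr mulrDr mulr1.
rewrite !opprD !opprK !addrA.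
by rewrite [LHS](ACl (4*5*6*2*3*1))%AC.
Qed.

(** [(2 A - 1)^2 = 4 (A^2 - A) + 1] with [A^2 - A] positive. *)
Let K_invertible : invertible K.
Proof.
apply: invertible_sqr.
have -> : K * K = 4%:C *: (4^-1%:C *: 1 + (A * A - A)).
  rewrite scalerDr scalerA -rmorphM mulfV ?pnatr_eq0 // scale1r.
  rewrite rmorph_nat scaler_nat -expr2 /K -mulr2n sqrrB1 exprMn_n -mulrnA mulrnBl.
  by rewrite addrC.
apply: invertibleZ; first by rewrite eq_complex /= pnatr_eq0.
by apply: positive_invertible => //; rewrite invr_gt0.
Qed.

(** [P (1 - Q)] and [(1 - P) Q] each have only one nonzero row, so that both are
    of this form, with different [i]. *)
Let row_polarP (T : mxalg2 B) i : T * star T = corner i (D * K) ->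
  has_polar_decomposition (@cnorm R (mxalg2 B)) T <->
  exists p, range_projection D p.
Proof.
move=> TT; split.
  move=> /polarP[q /range_projection_mul_star]; rewrite TT => rq.
  have /range_projection_corner[p] := ex_intro _ q rq.
  by move=> /(range_projection_mul_invertible _ _ K_invertible) rp; exists p.
move=> [p /(range_projection_mul_invertible _ _ K_invertible) rp].
have /range_projection_corner - /(_ i)[q rq] := ex_intro _ p rp.
by apply/polarP; exists q; apply/range_projection_mul_star; rewrite TT.
Qed.

Lemma semi_harmoniousP : semi_harmonious (@cnorm R (mxalg2 B)) P Q <->
  exists p, range_projection D p.
Proof.
have simp := (mulr0, mul0r, mulr1, mul1r, addr0, add0r, oppr0).
have PQ : P * (1 - Q) = mx22 (1 - A) ell 0 0.
  by rewrite /P /Q mx22_1 mx22N mx22D mx22M !(simp, sub0r, opprK).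
have QP : (1 - P) * Q = mx22 0 0 ell (1 - A).
  by rewrite /P /Q mx22_1 mx22N mx22D mx22M subrr !(simp, subr0).
have e1 : P * (1 - Q) * star (P * (1 - Q)) = corner ord0 (D * K).
  rewrite PQ star_mx22 mx22M s1A sell !star0 !simp DK.
  by apply/matrixP; apply: ord2P; apply: ord2P; rewrite !mxE.
have e2 : (1 - P) * Q * star ((1 - P) * Q) = corner (lift ord0 ord0) (D * K).
  rewrite QP star_mx22 mx22M s1A sell !star0 !simp [_ + _]addrC DK.
  by apply/matrixP; apply: ord2P; apply: ord2P; rewrite !mxE.
split=> [[_ /(row_polarP e1)]//|rp]; split; first exact: quasi_pair.
  exact/(row_polarP e1).
exact/(row_polarP e2).
Qed.

End Pair.

Theorem theorem3p11 (R : realType) (B : cstarAlgType R) (A : B)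
    (hA : selfadjoint A) (hpos : positive_elt (A * A - A)) :
  let ell : B := sqrt_elt (A * A - A) in
  let P : mxalg2 B := mx22 1 0 0 0 in
  let Q : mxalg2 B := mx22 A (- ell) ell (1 - A) in
  semi_harmonious (@mx_opnorm R B) P Q <->
  set_sum (norm_closure (@cnorm R B) (op_range (A - 1))) (op_kernel (A - 1)) 1.
Proof.
move=> ell P Q; apply: (iff_trans (semi_harmoniousP hA hpos)).
apply: iff_sym; apply: range_kernel_decompositionP.
by rewrite /selfadjoint starB hA star1.
Qed.
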